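(* Let $\beta=\alpha_{i_1}+\cdots+\alpha_{i_n}\in Q_n^+$ with $i_1,\dots,i_n\in I$ pairwise distinct. For any $\Lambda\in P^+$, the algebra homomorphism $Z(\mathscr{R}_\beta)\to Z(\mathscr{R}_\beta^\Lambda)$ induced by the canonical surjection $\mathscr{R}_\beta\to\mathscr{R}_\beta^\Lambda$ is surjective.
   Context: **Cartan datum.** $I$ is an index set and $A=(a_{ij})_{i,j\in I}$ is a symmetrizable generalized Cartan matrix (integral; $a_{ii}=2$; $a_{ij}\le 0$ for $i\ne j$; $a_{ij}=0\Leftrightarrow a_{ji}=0$; there are $d_i\in\mathbb{Z}_{>0}$ with $(d_ia_{ij})$ symmetric). $P$ is a free abelian group of finite rank, $P^\vee=\mathrm{Hom}(P,\mathbb{Z})$ with natural pairing $\langle\cdot,\cdot\rangle:P^\vee\times P\to\mathbb{Z}$; there are linearly independent simple roots $\alpha_i\in P$, simple coroots $\alpha_i^\vee\in P^\vee$ with $\langle\alpha_i^\vee,\alpha_j\rangle=a_{ij}$, and fundamental weights $\Lambda_i\in P$ with $\langle\alpha_j^\vee,\Lambda_i\rangle=\delta_{ij}$. $P^+=\{\lambda\in P:\langle\alpha_i^\vee,\lambda\rangle\ge0\ \forall i\}$, $Q_n^+=\{\sum_i k_i\alpha_i:k_i\in\mathbb{Z}_{\ge0},\sum_i k_i=n\}$. Put $(\alpha_i,\alpha_j)=d_ia_{ij}$. $\mathfrak{S}_n$ acts on $I^n$ by $w.\nu=(\nu_{w^{-1}(1)},\dots,\nu_{w^{-1}(n)})$;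 $I^\beta=\{\nu\in I^n:\sum_k\alpha_{\nu_k}=\beta\}$; $s_k=(k,k+1)$. **KLR algebra.** $\mathbf{k}$ is a field. Fix $Q_{i,j}\in\mathbf{k}[u,v]$ with $Q_{i,i}=0$, $Q_{i,j}(u,v)=Q_{j,i}(v,u)$, and for $i\ne j$, $Q_{i,j}(u,v)=\sum_{p,q\ge0}c_{i,j,p,q}u^pv^q$ where $c_{i,j,p,q}=0$ unless $(\alpha_i,\alpha_i)p+(\alpha_j,\alpha_j)q=-2(\alpha_i,\alpha_j)$, and $c_{i,j,-a_{ij},0}\ne0$. $\mathscr{R}_\beta$ is the associative $\mathbf{k}$-algebra generated by $e(\nu)$ ($\nu\in I^\beta$), $x_1,\dots,x_n$, $\tau_1,\dots,\tau_{n-1}$ with relations: $e(\nu)e(\nu')=\delta_{\nu\nu'}e(\nu)$, $\sum_\nu e(\nu)=1$, $x_kx_l=x_lx_k$, $x_ke(\nu)=e(\nu)x_k$, $\tau_le(\nu)=e(s_l.\nu)\tau_l$, $\tau_k\tau_l=\tau_l\tau_k$ if $|k-l|>1$, $\tau_k^2e(\nu)=Q_{\nu_k,\nu_{k+1}}(x_k,x_{k+1})e(\nu)$; $(\tau_kx_l-x_{s_k(l)}\tau_k)e(\nu)=-e(\nu)$ if $l=k,\nu_k=\nu_{k+1}$, $=e(\nu)$ if $l=k+1,\nu_k=\nu_{k+1}$, and $=0$ otherwise; $(\tau_{k+1}\tau_k\tau_{k+1}-\tau_k\tau_{k+1}\tau_k)e(\nu)=\frac{Q_{\nu_k,\nu_{k+1}}(x_k,x_{k+1})-Q_{\nu_{k+2},\nu_{k+1}}(x_{k+2},x_{k+1})}{x_k-x_{k+2}}e(\nu)$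 if $\nu_k=\nu_{k+2}$, and $=0$ otherwise. **Cyclotomic quotient.** For $\Lambda\in P^+$, $\mathscr{R}_\beta^\Lambda=\mathscr{R}_\beta/I_{\Lambda,\beta}$, where $I_{\Lambda,\beta}$ is the two-sided ideal generated by $\sum_{\nu\in I^\beta}x_1^{\langle\alpha_{\nu_1}^\vee,\Lambda\rangle}e(\nu)$. $Z(-)$ denotes the center. *)

(* Defs.v *)
From HB Require Import structures.
From mathcomp Require Import all_boot all_fingroup all_algebra generic_quotient boolp.
From mathcomp.multinomials Require Import monalg.
Set Implicit Arguments.
Unset Strict Implicit.
Unset Printing Implicit Defensive.
Import GRing.Theory.
Local Open Scope ring_scope.
Local Open Scope quotient_scope.

(* The library's algType excludes the zero ring, and R^Lambda_beta may vanish: *)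
(* an algebra is here a possibly trivial ring with a central morphism from k.  *)
HB.mixin Record isPzAlgebra (k : pzRingType) A of GRing.PzRing A := {
  scal : k -> A;
  scal_zmod : zmod_morphism scal;
  scal_monoid : monoid_morphism scal;
  scalC : forall (c : k) (a : A), scal c * a = a * scal c
}.
#[short(type="pzAlgType")]
HB.structure Definition PzAlgebra (k : pzRingType) :=
  {A of GRing.PzRing A & isPzAlgebra k A}.

HB.instance Definition _ (k : pzRingType) (A : pzAlgType k) :=
  GRing.isZmodMorphism.Build k A (@scal k A) scal_zmod.
HB.instance Definition _ (k : pzRingType) (A : pzAlgType k) :=
  GRing.isMonoidMorphism.Build k A (@scal k A) scal_monoid.

Section FreeAlgebra.
Variables (k : comNzRingType) (G : choiceType).

(* The algebra of the free (noncommutative) monoid {fmonom G}. *)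
Definition freealg : Type := {malg k[{fmonom G}]}.
HB.instance Definition _ := GRing.NzRing.on freealg.

Definition free_scal (c : k) : freealg := c%:MP.
Lemma free_scal_zmod : zmod_morphism free_scal.
Proof. by move=> c d; rewrite /free_scal raddfB. Qed.
Lemma free_scal_monoid : monoid_morphism free_scal.
Proof. by split=> [|c d]; rewrite /free_scal ?rmorph1 ?rmorphM. Qed.
Lemma free_scalC (c : k) (a : freealg) : free_scal c * a = a * free_scal c.
Proof.
rewrite [LHS](@mul_malgC {fmonom G} k c a) [RHS]malgM_def fgmulgU malgZ_def.
by apply: eq_bigr => i _; rewrite mulm1 mulrC.
Qed.
HB.instance Definition _ :=
  isPzAlgebra.Build k freealg free_scal_zmod free_scal_monoid free_scalC.

Definition freegen (g : G) : freealg := << fmu g >>.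
End FreeAlgebra.

Section IdealQuotient.
Variables (A : pzRingType) (S : A -> Prop).

Inductive in_ideal : A -> Prop :=
| in_ideal_gen a of S a : in_ideal a
| in_ideal_0 : in_ideal 0
| in_ideal_B a b of in_ideal a & in_ideal b : in_ideal (a - b)
| in_ideal_Ml c a of in_ideal a : in_ideal (c * a)
| in_ideal_Mr c a of in_ideal a : in_ideal (a * c).

Definition ideal : {pred A} := fun a => `[< in_ideal a >].

Lemma idealP a : reflect (in_ideal a) (a \in ideal).
Proof. exact: asboolP. Qed.

Lemma ideal_zmod_closed : zmod_closed ideal.
Proof.
split=> [|a b /idealP Ia /idealP Ib]; apply/idealP; first exact: in_ideal_0.
exact: in_ideal_B.
Qed.
HB.instance Definition _ := GRing.isZmodClosed.Build A ideal ideal_zmod_closed.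

Definition idealquot : Type := Quotient.quot ideal.
HB.instance Definition _ := GRing.Zmodule.on idealquot.
HB.instance Definition _ := EqQuotient.on idealquot.

Definition quot_pi (a : A) : idealquot := \pi_(Quotient.quot ideal) a.

Lemma quot_pi_eq a b : (quot_pi a = quot_pi b) <-> in_ideal (a - b).
Proof.
split=> [/eqP|/idealP h]; last by apply/eqP; rewrite /quot_pi -Quotient.idealrBE.
by rewrite /quot_pi -Quotient.idealrBE => /idealP.
Qed.

Lemma quot_pi_repr (u : idealquot) : quot_pi (repr u) = u.
Proof. exact: reprK. Qed.

Lemma quot_pi_surj (u : idealquot) : exists a, quot_pi a = u.
Proof. by exists (repr u); rewrite quot_pi_repr. Qed.

Lemma quot_pi_zmod : zmod_morphism quot_pi.
Proof. by move=> a b; rewrite /quot_pi !piE. Qed.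
HB.instance Definition _ :=
  GRing.isZmodMorphism.Build A idealquot quot_pi quot_pi_zmod.

Definition quot_one : idealquot := quot_pi 1.
Definition quot_mul (u v : idealquot) : idealquot := quot_pi (repr u * repr v).

Lemma quot_mulE a b : quot_mul (quot_pi a) (quot_pi b) = quot_pi (a * b).
Proof.
apply/quot_pi_eq; set a' := repr _; set b' := repr _.
have ha : in_ideal (a' - a) by apply/quot_pi_eq; rewrite quot_pi_repr.
have hb : in_ideal (b' - b) by apply/quot_pi_eq; rewrite quot_pi_repr.
have -> : a' * b' - a * b = (a' - a) * b' - (- (a * (b' - b))).
  by rewrite opprK mulrBl mulrBr addrA subrK.
apply: in_ideal_B; first exact: in_ideal_Mr.
by rewrite -mulNr; apply: in_ideal_Ml.
Qed.

Let E := quot_pi_repr.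

Lemma quot_mulA : associative quot_mul.
Proof.
by move=> u v w; rewrite -(E u) -(E v) -(E w) !quot_mulE mulrA.
Qed.
Lemma quot_mul1l : left_id quot_one quot_mul.
Proof. by move=> u; rewrite -(E u) quot_mulE mul1r. Qed.
Lemma quot_mul1r : right_id quot_one quot_mul.
Proof. by move=> u; rewrite -(E u) quot_mulE mulr1. Qed.
Lemma quot_mulDl : left_distributive quot_mul +%R.
Proof.
by move=> u v w; rewrite -(E u) -(E v) -(E w) !quot_mulE -!raddfD quot_mulE mulrDl.
Qed.
Lemma quot_mulDr : right_distributive quot_mul +%R.
Proof.
by move=> u v w; rewrite -(E u) -(E v) -(E w) !quot_mulE -!raddfD quot_mulE mulrDr.
Qed.
HB.instance Definition _ := GRing.Zmodule_isPzRing.Build idealquot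
  quot_mulA quot_mul1l quot_mul1r quot_mulDl quot_mulDr.

Lemma quot_pi_monoid : monoid_morphism quot_pi.
Proof. by split=> // a b; rewrite [RHS]quot_mulE. Qed.
HB.instance Definition _ :=
  GRing.isMonoidMorphism.Build A idealquot quot_pi quot_pi_monoid.

End IdealQuotient.

Section IdealQuotientAlgebra.
Variables (k : pzRingType) (A : pzAlgType k) (S : A -> Prop).

Definition quot_scal (c : k) : idealquot S := quot_pi S (scal c).
Lemma quot_scal_zmod : zmod_morphism quot_scal.
Proof. by move=> c d; rewrite /quot_scal !raddfB. Qed.
Lemma quot_scal_monoid : monoid_morphism quot_scal.
Proof. by split=> [|c d]; rewrite /quot_scal ?rmorph1 ?rmorphM. Qed.
Lemma quot_scalC c u : quot_scal c * u = u * quot_scal c.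
Proof. by rewrite -(quot_pi_repr u) -!rmorphM scalC. Qed.
HB.instance Definition _ :=
  isPzAlgebra.Build k (idealquot S) quot_scal_zmod quot_scal_monoid quot_scalC.

Lemma quot_pi_scal (c : k) : quot_pi S (scal c) = scal c.
Proof. by []. Qed.
End IdealQuotientAlgebra.

Section Center.
Variable A : pzRingType.

Definition center : {pred A} := fun z => `[< forall a, z * a = a * z >].

Lemma centerP z : reflect (forall a, z * a = a * z) (z \in center).
Proof. exact: asboolP. Qed.

Lemma center_subring_closed : subring_closed center.
Proof.
split=> [|u v /centerP cu /centerP cv|u v /centerP cu /centerP cv];
  apply/centerP=> a.
- by rewrite mul1r mulr1.
- by rewrite mulrBl mulrBr cu cv.
- by rewrite -mulrA cv mulrA cu mulrA.
Qed.
HB.instance Definition _ :=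
  GRing.isSubringClosed.Build A center center_subring_closed.

Record centerType := CenterElt { center_val :> A; _ : center_val \in center }.
HB.instance Definition _ := [isSub for center_val].
HB.instance Definition _ := [Choice of centerType by <:].
HB.instance Definition _ := GRing.SubChoice_isSubPzRing.Build A center centerType
  (subringClosedP center).
End Center.
Arguments center : clear implicits.
Notation "''Z[' A ]" := (centerType A) (format "''Z[' A ]") : type_scope.

Section CenterAlgebra.
Variables (k : pzRingType) (A : pzAlgType k).

Lemma scal_center (c : k) : scal c \in center A.
Proof. by apply/centerP=> a; rewrite scalC. Qed.
Definition center_scal (c : k) : 'Z[A] := CenterElt (scal_center c).
Lemma center_scal_zmod : zmod_morphism center_scal.
Proof. by move=> c d; apply: val_inj; rewrite /= raddfB. Qed.
Lemma center_scal_monoid : monoid_morphism center_scal.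
Proof. by split=> [|c d]; apply: val_inj; rewrite /= ?rmorph1 ?rmorphM. Qed.
Lemma center_scalC c u : center_scal c * u = u * center_scal c.
Proof. by apply: val_inj; rewrite /= scalC. Qed.
HB.instance Definition _ := isPzAlgebra.Build k 'Z[A]
  center_scal_zmod center_scal_monoid center_scalC.
End CenterAlgebra.

Section CenterMap.
Variables (A : pzRingType) (S : A -> Prop).

Lemma quot_pi_center (z : 'Z[A]) : quot_pi S z \in center (idealquot S).
Proof.
have /centerP cz := valP z; apply/centerP=> u.
by have [a <-] := quot_pi_surj u; rewrite -!rmorphM cz.
Qed.

Definition center_pi (z : 'Z[A]) : 'Z[idealquot S] :=
  CenterElt (quot_pi_center z).

Lemma center_pi_zmod : zmod_morphism center_pi.
Proof. by move=> u v; apply: val_inj; rewrite /= !raddfB. Qed.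
HB.instance Definition _ :=
  GRing.isZmodMorphism.Build _ _ center_pi center_pi_zmod.
Lemma center_pi_monoid : monoid_morphism center_pi.
Proof. by split=> [|u v]; apply: val_inj; rewrite /= ?rmorph1 ?rmorphM. Qed.
HB.instance Definition _ :=
  GRing.isMonoidMorphism.Build _ _ center_pi center_pi_monoid.
End CenterMap.

Lemma center_pi_scal (k : pzRingType) (A : pzAlgType k) (S : A -> Prop) (c : k) :
  center_pi S (scal c) = scal c.
Proof. exact: val_inj. Qed.

Definition free_of_finite_rank (P : zmodType) : Prop :=
  exists (r : nat) (b : 'I_r -> P),
    forall x : P, exists! c : {ffun 'I_r -> int}, x = \sum_j b j *~ c j.

(* The dual lattice of P is {additive P -> int}, the pairing being evaluation. *)
(* I is finite because P has finite rank and the simple roots are linearly     *)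
(* independent.                                                                *)
Record cartan_datum (I : finType) := CartanDatum {
  cmat : I -> I -> int;
  cmat_diag : forall i, cmat i i = 2;
  cmat_le0 : forall i j, i != j -> cmat i j <= 0;
  cmat_eq0 : forall i j, cmat i j = 0 <-> cmat j i = 0;
  symz : I -> int;
  symz_gt0 : forall i, 0 < symz i;
  symz_sym : forall i j, symz i * cmat i j = symz j * cmat j i;
  wlat : zmodType;
  wlat_free : free_of_finite_rank wlat;
  sroot : I -> wlat;
  sroot_free : forall c : I -> int,
    \sum_i sroot i *~ c i = 0 -> forall i, c i = 0;
  scoroot : I -> {additive wlat -> int};
  scorootE : forall i j, scoroot i (sroot j) = cmat i j;
  fweight : I -> wlat;
  fweightE : forall i j, scoroot j (fweight i) = (i == j)%:R
}.

Section KLR.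
Variables (I : finType) (C : cartan_datum I).

Definition dominant (L : wlat C) : Prop := forall i, 0 <= scoroot C i L.

Definition root_form (i j : I) : int := symz C i * cmat C i j.

Variable k : fieldType.

(* For Q : {poly {poly k}} the outer indeterminate is u and the inner one v,   *)
(* so that Q`_p`_q is the coefficient of u ^ p v ^ q.                          *)
Record klr_polys (Q : I -> I -> {poly {poly k}}) : Prop := KLRPolys {
  klrQ_diag : forall i, Q i i = 0;
  klrQ_sym : forall i j, Q i j = swapXY (Q j i);
  klrQ_homog : forall i j (p q : nat), i != j ->
    root_form i i * p%:Z + root_form j j * q%:Z != - 2 * root_form i j ->
    (Q i j)`_p`_q = 0;
  klrQ_lead : forall i j, i != j -> (Q i j)`_(`|cmat C i j|%N)`_0 != 0
}.

Definition eval2 (A : pzAlgType k) (Q : {poly {poly k}}) (a b : A) : A :=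
  \sum_(p < size Q) \sum_(q < size Q`_p) scal Q`_p`_q * (a ^+ p * b ^+ q).

(* (Q(a, b) - Q(c, b)) / (a - c), for commuting a, b, c. *)
Definition divdiff (A : pzAlgType k) (Q : {poly {poly k}}) (a b c : A) : A :=
  \sum_(p < size Q) \sum_(q < size Q`_p)
    scal Q`_p`_q * ((\sum_(i < p) a ^+ (p.-1 - i) * c ^+ i) * b ^+ q).

Lemma divdiffE (A : pzAlgType k) Q (a b c : A) : GRing.comm a c ->
  (a - c) * divdiff Q a b c = eval2 Q a b - eval2 Q c b.
Proof.
move=> cac; rewrite /divdiff /eval2 mulr_sumr -sumrB; apply: eq_bigr => p _.
rewrite mulr_sumr -sumrB; apply: eq_bigr => q _.
by rewrite mulrA -scalC -mulrA [(a - c) * _]mulrA -subrXX_comm // mulrBl mulrBr.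
Qed.

Variables (Q : I -> I -> {poly {poly k}}) (n : nat) (beta : wlat C).

Definition weight_seq : Type :=
  {nu : n.-tuple I | \sum_(j < n) sroot C (tnth nu j) == beta}.
HB.instance Definition _ := SubFinite.on weight_seq.

Definition tuple_act (w : 'S_n) (nu : n.-tuple I) : n.-tuple I :=
  [tuple tnth nu ((w^-1)%g j) | j < n].

Lemma weight_act_proof (w : 'S_n) (nu : weight_seq) :
  \sum_(j < n) sroot C (tnth (tuple_act w (val nu)) j) == beta.
Proof.
apply/eqP; rewrite -[RHS](eqP (valP nu)).
rewrite [RHS](reindex_inj (@perm_inj _ (w^-1)%g)) /=.
by apply: eq_bigr => j _; rewrite tnth_mktuple.
Qed.
Definition weight_act (w : 'S_n) (nu : weight_seq) : weight_seq :=
  Sub (tuple_act w (val nu)) (weight_act_proof w nu).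

(* The index l : 'I_n.-1 of tau_l stands for the pair of positions l, l + 1.   *)
Definition posl (l : 'I_n.-1) : 'I_n := widen_ord (leq_pred n) l.
Lemma posr_proof (l : 'I_n.-1) : (l.+1 < n)%N.
Proof. by case: n l => [|m] [l]. Qed.
Definition posr (l : 'I_n.-1) : 'I_n := Ordinal (posr_proof l).
Definition simple_transp (l : 'I_n.-1) : 'S_n := tperm (posl l) (posr l).

Section Relations.
Variables (A : pzAlgType k).
Variables (e : weight_seq -> A) (x : 'I_n -> A) (t : 'I_n.-1 -> A).
Local Notation res nu j := (tnth (val (nu : weight_seq)) j).

(* The defining relations, as pairs (left-hand side, right-hand side). *)
Inductive klr_rel : A -> A -> Prop :=
| klr_ee nu nu' : klr_rel (e nu * e nu') (if nu == nu' then e nu else 0)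
| klr_e1 : klr_rel (\sum_nu e nu) 1
| klr_xx i j : klr_rel (x i * x j) (x j * x i)
| klr_xe i nu : klr_rel (x i * e nu) (e nu * x i)
| klr_te l nu : klr_rel (t l * e nu) (e (weight_act (simple_transp l) nu) * t l)
| klr_tt (l m : 'I_n.-1) of (l.+1 < m)%N || (m.+1 < l)%N : klr_rel (t l * t m) (t m * t l)
| klr_t2 l nu : klr_rel (t l ^+ 2 * e nu)
    (eval2 (Q (res nu (posl l)) (res nu (posr l))) (x (posl l)) (x (posr l))
     * e nu)
| klr_tx l i nu : klr_rel ((t l * x i - x (simple_transp l i) * t l) * e nu)
    (if (i == posl l) && (res nu (posl l) == res nu (posr l)) then - e nu
     else if (i == posr l) && (res nu (posl l) == res nu (posr l)) then e nu
     else 0)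
| klr_braid (l m : 'I_n.-1) nu of m = l.+1 :> nat :
    klr_rel ((t m * t l * t m - t l * t m * t l) * e nu)
    (if res nu (posl l) == res nu (posr m) then
       divdiff (Q (res nu (posl l)) (res nu (posr l)))
         (x (posl l)) (x (posr l)) (x (posr m)) * e nu
     else 0).
End Relations.

Definition klr_gen : choiceType := (weight_seq + 'I_n + 'I_n.-1)%type.
Definition klr_free : pzAlgType k := freealg k klr_gen.

Definition free_e (nu : weight_seq) : klr_free := freegen k (inl (inl nu) : klr_gen).
Definition free_x (i : 'I_n) : klr_free := freegen k (inl (inr i) : klr_gen).
Definition free_t (l : 'I_n.-1) : klr_free := freegen k (inr l : klr_gen).

Definition klr_relator (a : klr_free) : Prop :=
  exists b c, klr_rel free_e free_x free_t b c /\ a = b - c.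

Definition KLR := idealquot klr_relator.
HB.instance Definition _ := PzAlgebra.on KLR.

Definition klr_e (nu : weight_seq) : KLR := quot_pi klr_relator (free_e nu).
Definition klr_x (i : 'I_n) : KLR := quot_pi klr_relator (free_x i).
Definition klr_t (l : 'I_n.-1) : KLR := quot_pi klr_relator (free_t l).

(* For n = 0 there is no x_1 and no generator: the quotient is then KLR. *)
Definition cyclotomic_gen (L : wlat C) (a : KLR) : Prop :=
  exists2 i : 'I_n, i = 0 :> nat &
    a = \sum_(nu : weight_seq)
          klr_x i ^+ `|scoroot C (tnth (val nu) i) L|%N * klr_e nu.

Definition cycKLR (L : wlat C) := idealquot (cyclotomic_gen L).
HB.instance Definition _ (L : wlat C) := PzAlgebra.on (cycKLR L).

Definition klr_center_map (L : wlat C) : 'Z[KLR] -> 'Z[cycKLR L] :=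
  center_pi (cyclotomic_gen L).
HB.instance Definition _ (L : wlat C) := GRing.RMorphism.on (klr_center_map L).
End KLR.

(* Main.v *)
From HB Require Import structures.
Require Import Defs.
From mathcomp Require Import all_boot all_fingroup all_algebra zify.
From mathcomp Require Import finmap.
From mathcomp.multinomials Require Import monalg.
Set Implicit Arguments.
Unset Strict Implicit.
Unset Printing Implicit Defensive.
Import GRing.Theory.
Local Open Scope ring_scope.

(** Because the colours [i_1, .., i_n] are distinct, the weight sequences are
the rearrangements of [i], so they are indexed by permutations [s] of the
labels ['I_n], and no correction term survives in the relations of the KLR
algebra: a crossing [t l] simply exchanges two strands, its square is a
polynomial [q a b] in the dots of the two strands, and the braid relation is
exact. Writing [X a] for the dot on the strand of label [a], the elements [X a]
are central. So there is a morphism [phi] from the polynomial ring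
[S = k[X_1, .., X_n]] to the center, and every [e s * a * e s] lies in
[phi S * e s] ([diag_corner]).

Put [setpoly a D = X_a ^ (Lambda_a) * prod_(b in D) q a b] and, for a family
[B] of sets of labels, let [setideal B] be the ideal of [S] generated by the
[setpoly a (B a)]. With [before s a] the set of labels to the left of [a] in
[s], moving the strand [a] to the far left and back shows that
[setideal (before s)] annihilates [e s] in the cyclotomic quotient
([setpoly_in_ideal]). Conversely, if [f * t l * e s] vanishes in the quotient,
then [f] belongs to the ideal [setideal] of the sets
[before s a :&: before (swap l s) a] ([cyclotomic_crossing]). This is proved on
an explicit representation on the functions ['S_n -> S], one for each base
permutation, with a stable subspace that absorbs the cyclotomic ideal.

A central element [z] of the quotient is therefore a family of polynomials
[F s] such that [F s - F (swap l s)] lies in the ideal attached to the pair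
[s], [swap l s]. It lifts to the center as soon as one polynomial [f] satisfies
[f - F s \in setideal (before s)] for all [s] at once, and then [phi f] is the
lift. The existence of [f] is the heart of the proof ([glue]). It is built by
adding the permutations one by one in lexicographic order. Suppose that [f] is
correct for all permutations smaller than [s], and let [b] be a label with a
larger label on its left, the last of these being [a]. Sliding [b] to the left
past [a] produces a smaller permutation, and the congruences along the slide
put [f - F s] in the ideal obtained from [setideal (before s)] by replacing
the generator [setpoly b (before s b)] by its divisor
[p b = setpoly b (before s a)]. The intersection of these ideals over all such
[b] is [setideal (before s)] plus the multiples of [prod_b p b]
([gen_ideal_cap]), because each generator [setpoly b (before s b)] has a unit
leading coefficient in [X b] and otherwise involves only the variables of the
labels on the left of [b]. Finally [prod_b p b]
belongs to [setideal (before t)] for every [t] smaller than [s]: look at the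
first place where [s] and [t] differ. So subtracting a multiple of this product
corrects [f] at [s] without spoiling the smaller permutations. *)

(** * Ideals generated by a family *)

Section Ideal.
Variables (S : comPzRingType) (T : finType).
Implicit Types (t : T -> S) (f u : S).

(** The families are indexed by a fixed finite type and absent generators are
zero, so that changing one generator does not change the index type. *)
Definition gen_ideal t f := exists u : T -> S, f = \sum_a u a * t a.

Definition set_at t b p : T -> S := fun a => if a == b then p else t a.

Lemma set_atE t b p : set_at t b p b = p.
Proof. by rewrite /set_at eqxx. Qed.

Lemma gen_ideal0 t : gen_ideal t 0.
Proof. by exists (fun=> 0); rewrite big1 // => a _; rewrite mul0r. Qed.

Lemma gen_idealD t f f' : gen_ideal t f -> gen_ideal t f' -> gen_ideal t (f + f').
Proof.
case=> u -> [v ->]; exists (fun a => u a + v a).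
by rewrite -big_split; apply: eq_bigr => a _; rewrite mulrDl.
Qed.

Lemma gen_idealMl t u f : gen_ideal t f -> gen_ideal t (u * f).
Proof.
case=> v ->; exists (fun a => u * v a).
by rewrite mulr_sumr; apply: eq_bigr => a _; rewrite mulrA.
Qed.

Lemma gen_idealN t f : gen_ideal t f -> gen_ideal t (- f).
Proof. by move=> h; rewrite -mulN1r; apply: gen_idealMl. Qed.

Lemma gen_idealB t f f' : gen_ideal t f -> gen_ideal t f' -> gen_ideal t (f - f').
Proof. by move=> h h'; apply: gen_idealD => //; apply: gen_idealN. Qed.

Lemma gen_ideal_sum t (K : Type) (r : seq K) (P : pred K) (F : K -> S) :
  (forall x, P x -> gen_ideal t (F x)) -> gen_ideal t (\sum_(x <- r | P x) F x).
Proof. by move=> h; apply: big_ind => //; [exact: gen_ideal0 | exact: gen_idealD]. Qed.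

Lemma gen_ideal_mem t a : gen_ideal t (t a).
Proof.
exists (fun b => (b == a)%:R); rewrite (bigD1 a) //= eqxx mul1r big1 ?addr0 //.
by move=> b /negbTE->; rewrite mul0r.
Qed.

Lemma gen_ideal_sub t t' f : (forall a, gen_ideal t' (t a)) -> gen_ideal t f ->
  gen_ideal t' f.
Proof. by move=> h [u ->]; apply: gen_ideal_sum => a _; apply: gen_idealMl. Qed.

Lemma gen_ideal_mul_sub t t' u f :
  (forall a, gen_ideal t' (u * t a)) -> gen_ideal t f -> gen_ideal t' (u * f).
Proof.
move=> h [v ->]; rewrite mulr_sumr; apply: gen_ideal_sum => a _.
by rewrite mulrCA; apply: gen_idealMl.
Qed.

Lemma gen_ideal_set_at t b p f : gen_ideal (set_at t b p) f ->
  exists v, gen_ideal (set_at t b 0) (f - v * p).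
Proof.
case=> u ->; exists (u b); rewrite (bigD1 b) //= set_atE addrAC subrr add0r.
apply: gen_ideal_sum => a nab; apply: gen_idealMl.
by have := gen_ideal_mem (set_at t b 0) a; rewrite /set_at (negbTE nab).
Qed.

Lemma gen_ideal_set_at0 t b p f : gen_ideal (set_at t b 0) f ->
  gen_ideal (set_at t b p) f.
Proof.
apply: gen_ideal_sub => a; have := gen_ideal_mem (set_at t b p) a; rewrite /set_at.
by case: eqP => // _ _; apply: gen_ideal0.
Qed.

Lemma gen_ideal_set_atI t b p f v : gen_ideal (set_at t b 0) (f - v * p) ->
  gen_ideal (set_at t b p) f.
Proof.
move=> h; rewrite -(subrK (v * p) f); apply: gen_idealD; first exact: gen_ideal_set_at0.
by apply: gen_idealMl; have := gen_ideal_mem (set_at t b p) b; rewrite set_atE.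
Qed.

Lemma gen_ideal_ext t t' f : t =1 t' -> gen_ideal t f -> gen_ideal t' f.
Proof. by move=> e; apply: gen_ideal_sub => a; rewrite e; apply: gen_ideal_mem. Qed.

End Ideal.

(** * Polynomials whose leading coefficient is a unit *)

Section UnitLead.
Variable S : comNzRingType.

Definition unitlead (P : {poly S}) :=
  exists2 d, (exists v, P`_d * v = 1) & forall j, (d < j)%N -> P`_j = 0.

Lemma unitlead_cst (v w : S) : v * w = 1 -> unitlead v%:P.
Proof.
by move=> h; exists 0%N => [|[|j] //]; [exists w; rewrite coefC | rewrite coefC].
Qed.

Lemma unitleadX : unitlead 'X.
Proof.
exists 1%N => [|[|[|j]] //]; first by exists 1; rewrite coefX mulr1.
by rewrite coefX.
Qed.

Lemma coef_topM (P R : {poly S}) d e :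
  (forall j, (d < j)%N -> P`_j = 0) -> (forall j, (e < j)%N -> R`_j = 0) ->
  (P * R)`_(d + e) = P`_d * R`_e.
Proof.
move=> hP hR; rewrite coefM; have hd : (d < (d + e).+1)%N by rewrite ltnS leq_addr.
rewrite (bigD1 (Ordinal hd)) //= addKn big1 ?addr0 // => -[j hj] /eqP nj /=.
have [ltdj|] := ltnP d j; first by rewrite hP ?mul0r.
rewrite leq_eqVlt => /orP[/eqP ej|ltjd]; first by case: nj; apply: val_inj.
by rewrite hR ?mulr0 // ltn_subRL ltn_add2r.
Qed.

Lemma unitleadM P R : unitlead P -> unitlead R -> unitlead (P * R).
Proof.
move=> [d [v hv] hP] [e [w hw] hR]; exists (d + e)%N.
  by exists (v * w); rewrite coef_topM // mulrACA hv hw mulr1.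
move=> m hm; rewrite coefM big1 // => -[j hj] _ /=.
have [ltdj|ledj] := ltnP d j; first by rewrite hP ?mul0r.
rewrite hR ?mulr0 // ltn_subRL; apply: leq_ltn_trans hm.
by rewrite leq_add2r.
Qed.

Lemma unitlead_prod (K : Type) (r : seq K) (D : pred K) (F : K -> {poly S}) :
  (forall x, D x -> unitlead (F x)) -> unitlead (\prod_(x <- r | D x) F x).
Proof.
move=> h; apply: big_ind => //; last exact: unitleadM.
by apply: (@unitlead_cst 1 1); rewrite mulr1.
Qed.

Lemma unitleadXn (P : {poly S}) m : unitlead P -> unitlead (P ^+ m).
Proof.
move=> h; elim: m => [|m IH]; last by rewrite exprS; apply: unitleadM.
by apply: (@unitlead_cst 1 1); rewrite mulr1.
Qed.

(** A polynomial with a unit leading coefficient is a nonzerodivisor modulo any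
ideal extended from the coefficients: the top coefficient of [U] is, up to a
unit, the top coefficient of [P * U], so it lies in the ideal and can be split
off. *)
Lemma unitlead_nzd (T : finType) (t : T -> S) (P U : {poly S}) :
  unitlead P -> (forall j, gen_ideal t (P * U)`_j) -> forall j, gen_ideal t U`_j.
Proof.
case=> d [v hv] hP; move: {2}(size U) (leqnn (size U)) => s.
elim: s U => [|s IH] U hs hPU j.
  by move: hs; rewrite leqn0 size_poly_eq0 => /eqP->; rewrite coef0; apply: gen_ideal0.
have hU : gen_ideal t U`_s.
  have -> : U`_s = v * (P * U)`_(d + s).
    rewrite coef_topM ?mulrA 1?[v * _]mulrC ?hv ?mul1r // => m hm.
    by apply: nth_default; apply: leq_trans hm.
  exact: gen_idealMl.
pose U' := U - U`_s *: 'X^s.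
have := IH U' _ _ j.
rewrite /U' coefB coefZ coefXn => H; rewrite -(subrK (U`_s * (j == s)%:R) U`_j).
apply: gen_idealD; last by rewrite mulrC; apply: gen_idealMl.
apply: H => [|m].
  apply/leq_sizeP => m hm; rewrite coefB coefZ coefXn.
  have [->|nms] := eqVneq m s; first by rewrite mulr1 subrr.
  rewrite mulr0 subr0; apply: nth_default; apply: leq_trans hs _.
  by rewrite ltn_neqAle eq_sym nms.
rewrite mulrBr coefB -scalerAr coefZ; apply: gen_idealB => //.
by rewrite mulrC; apply: gen_idealMl.
Qed.

End UnitLead.

(** * Triangular systems of monic equations *)

Section Triangular.
Variables (S : comNzRingType) (T : finType) (r : T -> nat).
Variables (Phi : T -> {rmorphism S -> {poly S}}) (X : T -> S).
Hypothesis PhiK : forall c u, (Phi c u).[X c] = u.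
Hypothesis r_inj : injective r.
Implicit Types (t p h : T -> S).

(** [Phi c] rewrites an element of [S] as a polynomial in the variable [X c]
with coefficients in [S], so an element that does not involve [X c] is one that
[Phi c] sends to a constant. This gives access to leading terms in any chosen
variable without fixing an order of the variables. *)
Definition freeof c (q : S) := Phi c q = q%:P.

Definition triang c q :=
  unitlead (Phi c q) /\ forall d, (r c < r d)%N -> freeof d q.

Lemma freeof0 c : freeof c 0.
Proof. by rewrite /freeof rmorph0. Qed.

Lemma freeofM c u v : freeof c u -> freeof c v -> freeof c (u * v).
Proof. by rewrite /freeof rmorphM polyCM => -> ->. Qed.

Lemma freeof_prod c (K : Type) (s : seq K) (D : pred K) (F : K -> S) :
  (forall x, D x -> freeof c (F x)) -> freeof c (\prod_(x <- s | D x) F x).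
Proof.
by move=> h; apply: big_ind => //; [rewrite /freeof rmorph1 | apply: freeofM].
Qed.

(** [S] is a polynomial ring in [X c] over a ring that contains all the [t a],
so this is [unitlead_nzd] read through [Phi c]. *)
Lemma nzd_low c t q u : unitlead (Phi c q) -> (forall a, freeof c (t a)) ->
  gen_ideal t (q * u) -> gen_ideal t u.
Proof.
move=> hq ht [v e]; rewrite -(PhiK c u) horner_coef; apply: gen_ideal_sum => j _.
rewrite mulrC; apply: gen_idealMl; move: (nat_of_ord j); apply: unitlead_nzd hq _ => m.
rewrite -rmorphM e rmorph_sum coef_sum; apply: gen_ideal_sum => a _.
by rewrite rmorphM ht coefMC; apply: gen_idealMl; apply: gen_ideal_mem.
Qed.

Definition triang_family t := forall c, t c = 0 \/ triang c (t c).

Lemma triang_family_set_at t b q : triang_family t -> q = 0 \/ triang b q ->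
  triang_family (set_at t b q).
Proof. by move=> ht hq c; rewrite /set_at; case: eqP => [->|_]. Qed.

Lemma triang_family_free t c d : triang_family t -> (r c < r d)%N -> freeof d (t c).
Proof. by move=> /(_ c)[-> _|[_ h] /h //]; apply: freeof0. Qed.

(** Here the generators of rank above [b] may involve [X b]. They are added one at
a time. If [q * u = v * t c] modulo the smaller ones, then [v] lies in the
ideal of the smaller ones and [q], because [t c] is a nonzerodivisor modulo
these by [nzd_low]; writing [v = w * q] there and cancelling [q] by induction
leaves [u = w * t c]. *)
Lemma nzd_perm t b q u : triang_family t -> t b = 0 -> triang b q ->
  gen_ideal t (q * u) -> gen_ideal t u.
Proof.
move=> ht tb0 hq.
(* The family truncated to the ranks below [m]. *)
pose tr m : T -> S := fun c => if (r c < m)%N then t c else 0.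
suff H m v : gen_ideal (tr m) (q * v) -> gen_ideal (tr m) v.
  have E : t =1 tr (\max_c r c).+1.
    by move=> c; rewrite /tr ltnS leq_bigmax.
  by move=> h; apply/(gen_ideal_ext (fsym E))/H/(gen_ideal_ext E).
elim: m v => [|m IH] v; first by apply: (nzd_low (proj1 hq)) => a; exact: freeof0.
have [lemb|ltbm] := leqP m.+1 (r b).
  apply: (nzd_low (proj1 hq)) => a; rewrite /tr; case: ifP => ha; last exact: freeof0.
  by apply: triang_family_free => //; apply: leq_trans ha lemb.
have [c /eqP rc|nc] := pickP (fun c => r c == m); last first.
  have E : tr m.+1 =1 tr m.
    move=> c; rewrite /tr ltnS leq_eqVlt.
    by have := nc c; rewrite /= => ->.
  by move=> h; apply/(gen_ideal_ext (fsym E))/IH/(gen_ideal_ext E).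
have E : tr m.+1 =1 set_at (tr m) c (t c).
  move=> a; rewrite /tr /set_at ltnS leq_eqVlt -rc.
  by rewrite (inj_eq r_inj); case: eqP => [->|].
have E0 : set_at (tr m) c 0 =1 tr m.
  by move=> a; rewrite /tr /set_at; case: eqP => // ->; rewrite rc ltnn.
have [tc0|tc] := ht c.
  have E1 : tr m.+1 =1 tr m by move=> a; rewrite E -E0 tc0.
  by move=> h; apply/(gen_ideal_ext (fsym E1))/IH/(gen_ideal_ext E1).
have nbc : c != b by apply: contra_eqN tb0 => /eqP<-; apply/eqP => t0; move: (proj1 tc);
  rewrite t0 rmorph0 => -[d [w]]; rewrite coef0 mul0r => /eqP; rewrite eq_sym oner_eq0.
have rbm : (r b < m)%N.
  move: ltbm; rewrite ltnS leq_eqVlt -rc (inj_eq r_inj) eq_sym.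
  by rewrite (negbTE nbc).
move=> /(gen_ideal_ext E)/gen_ideal_set_at[w /(gen_ideal_ext E0) hw].
have : gen_ideal (set_at (tr m) b q) w.
  apply: (nzd_low (proj1 tc)) => [a|].
    rewrite /set_at; case: eqP => _.
      by apply: (proj2 hq); rewrite rc.
    rewrite /tr; case: ifP => ha; last exact: freeof0.
    by apply: triang_family_free => //; rewrite rc.
  rewrite -[t c * w](subKr (q * v)); apply: gen_idealB.
    by rewrite mulrC; apply: gen_idealMl;
      have := gen_ideal_mem (set_at (tr m) b q) b; rewrite set_atE.
  rewrite [t c * w]mulrC; apply: gen_ideal_sub hw => a.
  have := gen_ideal_mem (set_at (tr m) b q) a; rewrite /set_at; case: eqP => // -> _.
  by rewrite /tr tb0 if_same; apply: gen_ideal0.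
case/gen_ideal_set_at => w' hw'.
have {}hw' : gen_ideal (tr m) (w - w' * q).
  apply: gen_ideal_ext hw' => a; rewrite /set_at; case: eqP => // ->.
  by rewrite /tr tb0 if_same.
have := IH (v - w' * t c).
have -> : q * (v - w' * t c) = (q * v - w * t c) + t c * (w - w' * q).
  rewrite !mulrBr addrA [t c * w]mulrC subrK; congr (_ - _).
  by rewrite mulrA mulrC; congr (_ * _); rewrite mulrC.
move=> H; apply: (gen_ideal_ext (fsym E)); apply: (@gen_ideal_set_atI _ _ _ _ _ _ w').
apply: (gen_ideal_ext (fsym E0)); apply: H; apply: gen_idealD => //; exact: gen_idealMl.
Qed.

Definition set_on (s : seq T) p t : T -> S := fun a => if a \in s then p a else t a.

(** Dividing by [p a] replaces the generator [p a * h a] by [h a]: from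
[p a * (u - v * h a)] in the ideal of the other generators one cancels [p a] by
[nzd_perm]. *)
Lemma gen_ideal_colon (s : seq T) p h t u : uniq s -> triang_family t ->
  (forall a, a \in s -> [/\ t a = p a * h a, triang a (p a) & triang a (h a)]) ->
  gen_ideal t (u * \prod_(a <- s) p a) -> gen_ideal (set_on s h t) u.
Proof.
elim: s t u => [|b s IH] t u /=.
  by rewrite big_nil mulr1.
case/andP=> nbs us ht hs; rewrite big_cons.
have [tb pb hb] := hs b (mem_head _ _).
rewrite mulrCA => hu.
have : gen_ideal (set_at t b (p b * h b)) (p b * (u * \prod_(j <- s) p j)).
  by apply: gen_ideal_ext hu => a; rewrite /set_at; case: eqP => // ->.
case/gen_ideal_set_at => v; rewrite [v * _]mulrCA -mulrBr => hv.
have {}hv : gen_ideal (set_at t b (h b)) (u * \prod_(j <- s) p j).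
  apply: (@gen_ideal_set_atI _ _ _ _ _ _ v); apply: (nzd_perm _ _ pb hv).
    by apply: triang_family_set_at => //; left.
  exact: set_atE.
have := IH (set_at t b (h b)) u us _ _ hv.
have E : set_on s h (set_at t b (h b)) =1 set_on (b :: s) h t.
  move=> a; rewrite /set_on /set_at inE; case: eqP => //= ->.
  by rewrite (negbTE nbs).
move=> H; apply: (gen_ideal_ext E); apply: H.
  by apply: triang_family_set_at => //; right.
move=> a ha; have [] := hs a; first by rewrite inE ha orbT.
rewrite /set_at; case: eqP => // eab; by move: nbs; rewrite -eab ha.
Qed.

(** The intersection of the ideals where one generator [t b] is replaced by its
divisor [p b] contains no more than [t] and the multiples of the product of the
[p b]: once [f] is known to be [u * \prod_(a <- s) p a] modulo [t],
[gen_ideal_colon] shows that [u] lies in an ideal which this product multiplies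
into [t] plus [p b * \prod_(a <- s) p a]. *)
Lemma gen_ideal_cap (s : seq T) p h t f : uniq s -> triang_family t ->
  (forall a, a \in s -> [/\ t a = p a * h a, triang a (p a) & triang a (h a)]) ->
  (forall b, b \in s -> gen_ideal (set_at t b (p b)) f) ->
  exists u, gen_ideal t (f - u * \prod_(a <- s) p a).
Proof.
move=> us ht; elim: s us => [_ _ _|b s IH /= /andP[nbs us] hs hf].
  by exists f; rewrite big_nil mulr1 subrr; apply: gen_ideal0.
have hs' a : a \in s -> [/\ t a = p a * h a, triang a (p a) & triang a (h a)].
  by move=> ha; apply: hs; rewrite inE ha orbT.
have [|u hu] := IH us hs'; first by move=> a ha; apply: hf; rewrite inE ha orbT.
have [tb pb hb] := hs b (mem_head _ _).
have hu' : gen_ideal (set_at t b (p b)) (u * \prod_(a <- s) p a).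
  rewrite -[u * _](subKr f); apply: gen_idealB; first by apply: hf; apply: mem_head.
  apply: gen_ideal_sub hu => a; have := gen_ideal_mem (set_at t b (p b)) a.
  rewrite {2}/set_at; case: eqP => // -> h'; rewrite tb mulrC; exact: gen_idealMl.
have : gen_ideal (set_on s h (set_at t b (p b))) u.
  apply: gen_ideal_colon hu' => //; first by apply: triang_family_set_at => //; right.
  move=> a ha; have [] := hs' a ha.
  rewrite /set_at; case: eqP => // eab; by move: nbs; rewrite -eab ha.
have E : set_on s h (set_at t b (p b)) =1 set_at (set_on s h t) b (p b).
  by move=> a; rewrite /set_on /set_at; case: eqP => // ->; rewrite (negbTE nbs).
move/(gen_ideal_ext E)/gen_ideal_set_at => [w hw]; exists w.
rewrite big_cons mulrA -[f](subrK (u * \prod_(a <- s) p a)) -addrA -mulrBl.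
apply: gen_idealD => //; case: hw => z ->; rewrite mulr_suml;
  apply: gen_ideal_sum => a _.
rewrite -mulrA; apply: gen_idealMl; rewrite /set_at /set_on; case: eqP => _.
  by rewrite mul0r; apply: gen_ideal0.
case: ifP => ha; last by rewrite mulrC; apply: gen_idealMl; apply: gen_ideal_mem.
rewrite (big_rem a ha) /= mulrA [h a * _]mulrC; have [<- _ _] := hs' a ha.
by rewrite mulrC; apply: gen_idealMl; apply: gen_ideal_mem.
Qed.

End Triangular.

(** * The lexicographic order on permutations *)

Section Lex.
Variable n : nat.
Implicit Types (w : seq nat) (a : nat).

(** Reading a word over [0, .., n - 1] as a number in base [n] turns the
lexicographic order into the order of natural numbers. *)
Definition digits a w := foldl (fun a d => a * n + d)%N a w.

Lemma digits_lt a a' w w' : size w = size w' ->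
  all (fun d => d < n)%N w -> all (fun d => d < n)%N w' ->
  (a < a')%N -> (digits a w < digits a' w')%N.
Proof.
elim: w w' a a' => [|d w IH] [|d' w'] //= a a' [e] /andP[hd hw] /andP[hd' hw'] h.
apply: IH => //; apply: (@leq_trans (a.+1 * n)%N).
  by rewrite mulSn addnC ltn_add2r.
by apply: leq_trans (leq_addr _ _); rewrite leq_mul2r h orbT.
Qed.

Lemma digits_inj a w w' : size w = size w' ->
  all (fun d => d < n)%N w -> all (fun d => d < n)%N w' ->
  digits a w = digits a w' -> w = w'.
Proof.
elim: w w' a => [|d w IH] [|d' w'] //= a [e] /andP[hd hw] /andP[hd' hw'] h.
have [ltd|ltd|ed] := ltngtP d d'.
- by have := @digits_lt (a * n + d) (a * n + d') w w' e hw hw';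
    rewrite ltn_add2l ltd h ltnn => /(_ isT).
- have := @digits_lt (a * n + d') (a * n + d) w' w (esym e) hw' hw.
  by rewrite ltn_add2l ltd h ltnn => /(_ isT).
- by rewrite ed (IH w' _ e hw hw' (etrans h _)) // ed.
Qed.

Lemma digits_lex a w w' : size w = size w' ->
  all (fun d => d < n)%N w -> all (fun d => d < n)%N w' ->
  (digits a w < digits a w')%N <->
  exists k, [/\ (k < size w)%N, forall j, (j < k)%N -> nth 0%N w j = nth 0%N w' j
               & (nth 0%N w k < nth 0%N w' k)%N].
Proof.
elim: w w' a => [|d w IH] [|d' w'] //= a.
  by move=> *; rewrite ltnn; split=> // -[k []].
move=> [e] /andP[hd hw] /andP[hd' hw'].
have [ltd|ltd|ed] := ltngtP d d'.
- split=> _; first by exists 0%N.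
  by apply: digits_lt => //; rewrite ltn_add2l.
- split=> [h|[[|k] [_ hj hk]]].
  + have := @digits_lt (a * n + d') (a * n + d) w' w (esym e) hw' hw.
    by rewrite ltn_add2l ltd => /(_ isT); rewrite ltnNge (ltnW h).
  + by move: hk; rewrite /= ltnNge (ltnW ltd).
  + by have := hj 0%N isT => /= ed; rewrite ed ltnn in ltd.
- rewrite ed; split=> [/(IH w' _ e hw hw')[k [hk hj hlt]]|[[|k] [hk hj hlt]]].
  + by exists k.+1; split=> // -[|j] //= /hj.
  + by move: hlt; rewrite /= ltnn.
  + by apply/(IH w' _ e hw hw'); exists k; split=> // j /(hj j.+1).
Qed.

Definition lexkey (s : 'S_n) := digits 0 [seq (s j : nat) | j <- enum 'I_n].

Lemma nth_entries (s : 'S_n) (j : 'I_n) :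
  nth 0%N [seq (s j : nat) | j <- enum 'I_n] j = s j.
Proof. by rewrite (nth_map j) ?nth_ord_enum // size_enum_ord. Qed.

Lemma entries_lt (s : 'S_n) : all (fun d => d < n)%N [seq (s j : nat) | j <- enum 'I_n].
Proof. by apply/allP => _ /mapP[j _ ->]. Qed.

Lemma lexkey_inj : injective lexkey.
Proof.
move=> s t /digits_inj; rewrite !size_map => /(_ erefl (entries_lt s) (entries_lt t)) e.
by apply/permP => j; apply: val_inj; rewrite /= -!nth_entries e.
Qed.

Lemma lexkey_lt (s t : 'S_n) : (lexkey s < lexkey t)%N <->
  exists2 k : 'I_n, (forall j : 'I_n, (j < k)%N -> s j = t j) & (s k < t k)%N.
Proof.
have sz : size [seq (s j : nat) | j <- enum 'I_n] = n by rewrite size_map size_enum_ord.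
rewrite /lexkey digits_lex ?entries_lt //; last by rewrite !size_map.
rewrite sz; split=> [[k []]|[k hj hk]].
  move=> hk hj hlt; exists (Ordinal hk) => [j hjk|].
    by apply: val_inj; rewrite /= -!nth_entries hj.
  by rewrite -!nth_entries.
exists k; split=> // [j hjk|]; last by rewrite !nth_entries.
have hjn := ltn_trans hjk (ltn_ord k).
by have := hj (Ordinal hjn) hjk => /(congr1 val) /=; rewrite -!nth_entries.
Qed.

End Lex.

(** * Places of the labels in a permutation *)

Section Before.
Variable n : nat.
Implicit Types (s t : 'S_n) (l : 'I_n.-1) (a b c : 'I_n).

(** A permutation [s] stands for the word [s 0, s 1, ..] of labels, and
[place s a] is the position of the letter [a]. *)
Definition place s a : 'I_n := (s^-1)%g a.

Definition before s a : {set 'I_n} := [set b | (place s b < place s a)%N].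

Lemma placeK s a : s (place s a) = a.
Proof. exact: permKV. Qed.

Lemma permK_place s j : place s (s j) = j.
Proof. exact: permK. Qed.

Lemma place_inj s : injective (place s).
Proof. exact: perm_inj. Qed.

Definition swap l s : 'S_n := (simple_transp l * s)%g.

Lemma swapE l s j : swap l s j = s (simple_transp l j).
Proof. by rewrite permM. Qed.

Lemma swapK l : involutive (swap l).
Proof. by move=> s; rewrite /swap mulgA tperm2 mul1g. Qed.

Lemma place_swap l s a : place (swap l s) a = simple_transp l (place s a).
Proof. by rewrite /place invMg permM tpermV. Qed.

Lemma val_transp l j : simple_transp l j =
  (if j == l :> nat then l.+1 else if j == l.+1 :> nat then l : nat else j) :> nat.
Proof.
rewrite /simple_transp; case: tpermP => [->|->|/eqP n1 /eqP n2] /=.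
- by rewrite eqxx.
- by rewrite eqxx gtn_eqF.
- by rewrite -[j == l :> nat]/(j == posl l) -[_ == l.+1 :> nat]/(j == posr l) (negbTE
    n1) (negbTE n2).
Qed.

Lemma transp_lt l (i j : 'I_n) : (i < j)%N -> ~~ ((i == posl l) && (j == posr l)) ->
  (simple_transp l i < simple_transp l j)%N.
Proof.
rewrite !val_transp -!val_eqE /= => hij.
by case: eqP => h1; case: eqP => h2 //=; try case: eqP => h3 //=;
  try case: eqP => h4 //=; lia.
Qed.

(** Exchanging two neighbours removes a letter only from the left of the one that
moves left. *)
Lemma before_swap l s c : c != s (posr l) -> before s c \subset before (swap l s) c.
Proof.
move=> nc; apply/subsetP => b; rewrite !inE !place_swap => h.
apply: transp_lt => //; apply: contra nc => /andP[_ /eqP <-].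
by rewrite placeK.
Qed.

End Before.

(** * Gluing polynomials along adjacent permutations *)

Section Glue.
Variables (S : comNzRingType) (n : nat).
Variables (y : 'I_n -> S) (q : 'I_n -> 'I_n -> S).
Implicit Types (B : 'I_n -> {set 'I_n}) (D : {set 'I_n}) (s t : 'S_n) (f : S).

Definition setpoly a D := y a * \prod_(b in D) q a b.

Definition setideal B f := gen_ideal (fun a => setpoly a (B a)) f.

Lemma setpoly_sub a D D' : D' \subset D ->
  setpoly a D = setpoly a D' * \prod_(b in D :\: D') q a b.
Proof.
move=> /setIidPr e; rewrite /setpoly -mulrA; congr (_ * _).
by rewrite [LHS](big_setID D') /= e.
Qed.

Lemma setideal_mem B a D : B a \subset D -> setideal B (setpoly a D).
Proof.
move=> /(setpoly_sub a)->; rewrite mulrC; apply: gen_idealMl.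
exact: (gen_ideal_mem (fun a => setpoly a (B a)) a).
Qed.

Lemma setideal_sub B B' f : (forall a, B' a \subset B a) -> setideal B f ->
  setideal B' f.
Proof. by move=> h; apply: gen_ideal_sub => a; apply: setideal_mem. Qed.

Variables (Phi : 'I_n -> {rmorphism S -> {poly S}}) (X : 'I_n -> S).
Hypothesis PhiK : forall c u, (Phi c u).[X c] = u.
Hypothesis y_lead : forall a, unitlead (Phi a (y a)).
Hypothesis y_free : forall a c, a != c -> freeof Phi c (y a).
Hypothesis q_lead : forall a b, a != b -> unitlead (Phi a (q a b)).
Hypothesis q_free : forall a b c, a != c -> b != c -> freeof Phi c (q a b).

Definition place_rank s (a : 'I_n) : nat := place s a.

Lemma place_rank_inj s : injective (place_rank s).
Proof. by move=> a b /val_inj/place_inj. Qed.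

Lemma neq_before s a b : b \in before s a -> b != a.
Proof. by rewrite inE; apply: contraTneq => ->; rewrite ltnn. Qed.

Lemma triang_prod s a D : D \subset before s a ->
  triang (place_rank s) Phi a (\prod_(b in D) q a b).
Proof.
move=> /subsetP h; split.
  rewrite rmorph_prod; apply: unitlead_prod => b /h/neq_before.
  by rewrite eq_sym; apply: q_lead.
move=> d hd; apply: freeof_prod => b /h; rewrite inE => hb.
have neq x : (place_rank s x < place_rank s d)%N -> x != d.
  by apply: contraTneq => ->; rewrite ltnn.
by apply: q_free; apply: neq => //; apply: ltn_trans hd.
Qed.

Lemma triang_setpoly s a D : D \subset before s a ->
  triang (place_rank s) Phi a (setpoly a D).
Proof.
move=> /triang_prod[h1 h2]; split; first by rewrite rmorphM; apply: unitleadM.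
move=> d hd; apply: freeofM; last exact: h2.
by apply: y_free; apply: contraTneq hd => ->; rewrite ltnn.
Qed.

Variable F : 'S_n -> S.
Hypothesis F_swap : forall l s,
  setideal (fun a => before s a :&: before (swap l s) a) (F s - F (swap l s)).

Definition bigger_before s b a := (place s a < place s b)%N && (b < a)%N.

(** These letters are the ones that can be slid to the left so as to make the word
lexicographically smaller. *)
Definition nonrecords s := [set b | [exists a, bigger_before s b a]].

(** When [b] is a nonrecord, this union is [before s a] for the last larger letter
[a] on the left of [b]; taking the union avoids choosing [a]. *)
Definition cut s b : {set 'I_n} :=
  \bigcup_(a | bigger_before s b a) before s a.

Lemma cut_sub s b : cut s b \subset before s b.
Proof.
apply/bigcupsP => a /andP[h _]; apply/subsetP => c; rewrite !inE => h'.
exact: ltn_trans h.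
Qed.

(** The letter [b] moves left one step at a time down to the place of the last
larger letter [s k]. On the way the sets on the left of the other letters only
grow, and that of [b] still contains the cut; so every congruence used on the
way holds modulo the ideal where the generator of [b] is cut. *)
Lemma slide_left s b k : bigger_before s b (s k) -> cut s b = before s (s k) ->
  forall d, (d <= place s b - k)%N -> exists t,
  [/\ forall j : 'I_n, (j < place s b - d)%N -> t j = s j,
      place t b = (place s b - d)%N :> nat,
      forall c, c != b -> before s c \subset before t c &
      setideal (fun c => if c == b then cut s b else before s c) (F s - F t)].
Proof.
move=> hk ek; have /andP[] := hk; rewrite permK_place => hkb _.
elim=> [|d IH] hd.
  by exists s; split=> //; [rewrite subn0 | rewrite subrr; apply: gen_ideal0].
have [t [ht tb hB hF]] := IH (ltnW hd).
have hl : ((place s b - d).-1 < n.-1)%N by have := ltn_ord (place s b); lia.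
pose l : 'I_n.-1 := Ordinal hl.
have eb : b = t (posr l).
  rewrite -[LHS](placeK t); congr (t _); apply: val_inj; rewrite /= tb; lia.
have agree (j : 'I_n) : (j < place s b - d.+1)%N -> swap l t j = s j.
  move=> hj; rewrite swapE -ht; last by lia.
  congr (t _); apply: val_inj; rewrite /= val_transp /=.
  by rewrite !ltn_eqF //; lia.
have cutP t' (j : nat) : (forall i : 'I_n, (i < j)%N -> t' i = s i) ->
    (k <= j)%N -> place t' b = j :> nat -> cut s b \subset before t' b.
  move=> h hkj e; rewrite ek; apply/subsetP => x; rewrite !inE permK_place e => hx.
  have := h (place s x) (leq_trans hx hkj); rewrite placeK => {1}<-.
  by rewrite permK_place; apply: leq_trans hx hkj.
have swb : place (swap l t) b = (place s b - d.+1)%N :> nat.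
  rewrite place_swap val_transp tb /= gtn_eqF; last by lia.
  by rewrite prednK ?eqxx; lia.
exists (swap l t); split=> // [c nc|].
  by apply: (subset_trans (hB c nc)); apply: before_swap; rewrite -eb.
rewrite -(subrKA (F t)); apply: gen_idealD => //.
apply: setideal_sub (F_swap l t) => c; rewrite subsetI; case: eqP => [->|/eqP nc].
  by rewrite (cutP t (place s b - d)%N) ?(cutP (swap l t) (place s b - d.+1)%N) //; lia.
rewrite hB //; apply: (subset_trans (hB c nc)); apply: before_swap.
by rewrite -eb.
Qed.

(** The slide ends at a lexicographically smaller permutation, where [f] is
already correct. *)
Lemma near_cut s f b :
  (forall t, (lexkey t < lexkey s)%N -> setideal (before t) (f - F t)) ->
  b \in nonrecords s ->
  setideal (fun c => if c == b then cut s b else before s c) (f - F s).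
Proof.
rewrite inE => hf /existsP[a0 ha0].
case: (arg_maxnP (fun a => place s a : nat) ha0) => a ha amax.
have ek : cut s b = before s a.
  apply/eqP; rewrite eqEsubset (bigcup_sup a) // andbT.
  apply/bigcupsP => c /amax hc; apply/subsetP => x; rewrite !inE => h.
  exact: leq_trans h hc.
rewrite -[a in before s a](placeK s) in ek; rewrite -[a](placeK s) in ha.
have [t [ht tb hB hF]] := slide_left ha ek (leqnn _).
have /andP[hkb hba] := ha; rewrite permK_place in hkb.
have le_ab := ltnW hkb; rewrite subKn // in ht tb.
rewrite -(subrKA (F t)) -[F t - F s]opprB; apply: gen_idealB => //.
apply: setideal_sub (hf t _) => [c|].
  case: eqP => [->|/eqP]; last exact: hB.
  rewrite ek; apply/subsetP => x; rewrite !inE permK_place tb => hx.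
  have := ht (place s x) hx; rewrite placeK => {1}<-; by rewrite permK_place.
apply/lexkey_lt; exists (place s a) => //.
have -> : place s a = place t b by apply: val_inj.
by rewrite placeK (_ : place t b = place s a) //; apply: val_inj.
Qed.

(** At the first place [k] where [t] is smaller than [s], the letter [t k] comes
later in [s] and has the larger letter [s k] on its left; what precedes [t k] in
[t] precedes [s k] in [s], hence lies in the cut. *)
Lemma prod_cut_lt s t : (lexkey t < lexkey s)%N ->
  setideal (before t) (\prod_(b <- enum (nonrecords s)) setpoly b (cut s b)).
Proof.
case/lexkey_lt => k hj hk; set b := t k.
have pb : (k < place s b)%N.
  rewrite ltnNge; apply/negP; rewrite leq_eqVlt => /orP[/eqP e|h].
    have /(congr1 s) : place s b = k by apply: val_inj.
    by rewrite placeK => eb; rewrite -eb ltnn in hk.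
  have := hj _ h; rewrite placeK => /perm_inj e.
  by rewrite e ltnn in h.
have bb : bigger_before s b (s k) by rewrite /bigger_before permK_place pb.
have bN : b \in enum (nonrecords s).
  by rewrite mem_enum inE; apply/existsP; exists (s k).
rewrite (big_rem b bN) /= mulrC; apply: gen_idealMl.
have sub : before t b \subset cut s b.
  apply: subset_trans (bigcup_sup _ bb); apply/subsetP => x.
  rewrite !inE !permK_place => hx; have := hj _ hx; rewrite placeK => ->.
  by rewrite permK_place.
exact: setideal_mem.
Qed.

Lemma glue_step s f :
  (forall t, (lexkey t < lexkey s)%N -> setideal (before t) (f - F t)) ->
  exists f', forall t, (lexkey t <= lexkey s)%N -> setideal (before t) (f' - F t).
Proof.
move=> hf; pose g a := setpoly a (before s a).
have trg : triang_family (place_rank s) Phi g by move=> a; right; apply: triang_setpoly.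
have [a _||u hu] := @gen_ideal_cap _ _ _ _ _ PhiK (@place_rank_inj s) (enum
  (nonrecords s))
  (fun b => setpoly b (cut s b)) (fun b => \prod_(c in before s b :\: cut s b) q b c)
  g (f - F s) (enum_uniq _) trg.
- split; first exact: setpoly_sub (cut_sub s a).
    exact: triang_setpoly (cut_sub s a).
  by apply: triang_prod; apply: subsetDl.
- move=> b; rewrite mem_enum => /(near_cut hf); apply: gen_ideal_ext => a.
  by rewrite /set_at; case: eqP => [->|].
- exists (f - u * \prod_(b <- enum (nonrecords s)) setpoly b (cut s b)) => t.
  rewrite leq_eqVlt addrAC => /orP[/eqP/lexkey_inj->//|lt].
  by apply: gen_idealB; [exact: hf | apply: gen_idealMl; apply: prod_cut_lt].
Qed.

(** The congruences between neighbours [s] and [swap l s] alone suffice to glue. *)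
Theorem glue : exists f, forall s, setideal (before s) (f - F s).
Proof.
suff H m : exists f, forall t, (lexkey t < m)%N -> setideal (before t) (f - F t).
  have [f hf] := H (\max_(s : {perm 'I_n}) lexkey s).+1; exists f => s; apply: hf.
  by rewrite ltnS (bigD1 s) //= leq_maxl.
elim: m => [|m [f hf]]; first by exists 0.
have [s /eqP es|no] := pickP (fun s => lexkey s == m).
  by case: (@glue_step s f) => [|f' hf']; [rewrite es | exists f' => t ht;
    apply: hf'; rewrite es].
exists f => t; rewrite ltnS leq_eqVlt.
by have := no t; rewrite /= => -> /=; apply: hf.
Qed.

End Glue.

(** * Universal properties of monoid algebras and quotients *)

Section MonoidAlgebra.
Variables (k : comNzRingType) (M : monomType) (B : pzRingType).
Variables (f : {rmorphism k -> B}) (h : M -> B).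
Hypothesis h1 : h mone = 1.
Hypothesis hM : forall m m' : M, h (mmul m m') = h m * h m'.
Hypothesis hC : forall c m, f c * h m = h m * f c.

Definition malg_eval (g : {malg k[M]}) : B := \sum_(m <- msupp g) f g@_m * h m.

Lemma malg_evalw (d : {fset M}) g : (msupp g `<=` d)%fset ->
  malg_eval g = \sum_(m <- d) f g@_m * h m.
Proof.
move=> le; apply: big_fset_incl => // m _ /mcoeff_outdom ->.
by rewrite rmorph0 mul0r.
Qed.

Lemma malg_evalU c m : malg_eval << c *g m >> = f c * h m.
Proof. by rewrite (malg_evalw msuppU_le) big_seq_fset1 mcoeffUU. Qed.

Lemma malg_eval_zmod : zmod_morphism malg_eval.
Proof.
move=> g g'; pose d := (msupp (g - g') `|` (msupp g `|` msupp g'))%fset.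
have s1 : (msupp (g - g') `<=` d)%fset by apply: fsubsetUl.
have s2 : (msupp g `<=` d)%fset.
  by apply: fsubset_trans (fsubsetUr _ _); apply: fsubsetUl.
have s3 : (msupp g' `<=` d)%fset.
  by apply: fsubset_trans (fsubsetUr _ _); apply: fsubsetUr.
rewrite (malg_evalw s1) (malg_evalw s2) (malg_evalw s3) -sumrB.
by apply: eq_bigr => m _; rewrite mcoeffB rmorphB mulrBl.
Qed.

HB.instance Definition _ :=
  GRing.isZmodMorphism.Build {malg k[M]} B malg_eval malg_eval_zmod.

Lemma malg_eval_monoid : monoid_morphism malg_eval.
Proof.
split=> [|g g'].
  have -> : malg_eval 1 = f 1 * h mone := malg_evalU 1 mone.
  by rewrite h1 rmorph1 mulr1.
rewrite malgME [LHS]raddf_sum mulr_suml; apply: eq_bigr => m _.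
rewrite [LHS]raddf_sum mulr_sumr; apply: eq_bigr => m' _.
by rewrite /= malg_evalU rmorphM hM -mulrA [f _ * (h m * _)]mulrA hC !mulrA.
Qed.

(** The target [B] may be trivial: in the applications it is the center of an
algebra that is only known by generators and relations. *)
Lemma malg_univ : {Psi : {rmorphism {malg k[M]} -> B} |
  forall c m, Psi << c *g m >> = f c * h m}.
Proof.
pose z := GRing.isZmodMorphism.Build {malg k[M]} B malg_eval malg_eval_zmod.
pose m := GRing.isMonoidMorphism.Build {malg k[M]} B malg_eval malg_eval_monoid.
pose Psi : {rmorphism {malg k[M]} -> B} := HB.pack malg_eval z m.
by exists Psi => c mm; apply: malg_evalU.
Qed.
End MonoidAlgebra.

Lemma malgU_mul (k : comNzRingType) (M : monomType) (c d : k) (m m' : M) :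
  << c *g m >> * << d *g m' >> = << c * d *g (mmul m m') >>.
Proof.
rewrite (malgMEw msuppU_le msuppU_le) big_seq_fset1 big_seq_fset1.
by rewrite !mcoeffUU.
Qed.

Section FreeAlgebraTheory.
Variables (k : comNzRingType) (G : choiceType).

Lemma freealg_univ (B : pzRingType) (f : {rmorphism k -> B}) (h : G -> B) :
  (forall c g, f c * h g = h g * f c) ->
  exists Psi : {rmorphism freealg k G -> B},
    (forall c, Psi (scal c) = f c) /\ forall g, Psi (freegen k g) = h g.
Proof.
move=> hC; pose H (m : {fmonom G}) := \prod_(g <- fmonom_val m) h g.
have [|m m'|c m|Psi hPsi] := @malg_univ k {fmonom G} B f H.
- by rewrite /H fm1 big_nil.
- by rewrite /H fmM big_cat.
- rewrite /H; elim: (fmonom_val m) => [|g w IH]; first by rewrite big_nil mulr1 mul1r.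
  by rewrite big_cons mulrA hC -mulrA IH mulrA.
exists Psi; split=> [c|g].
  by rewrite [LHS]hPsi /H fm1 big_nil mulr1.
by rewrite [LHS]hPsi rmorph1 mul1r /H fmU big_seq1.
Qed.

Lemma freealg_ind (P : freealg k G -> Prop) :
  P 1 -> (forall a b, P a -> P b -> P (a + b)) ->
  (forall c a, P a -> P (scal c * a)) ->
  (forall g a, P a -> P (freegen k g * a)) -> forall a, P a.
Proof.
move=> h1 hD hZ hG a.
have h0 : P 0 by rewrite -(mul0r 1) -(rmorph0 (@scal k (freealg k G))); apply: hZ.
pose mon (m : {fmonom G}) : freealg k G := @mkmalgU {fmonom G} k m 1.
rewrite [a]monalgE; apply: big_ind => // m _.
have -> : << a@_m *g m >> = scal a@_m * mon m.
  by rewrite [RHS]malgU_mul mulr1 mul1m.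
apply: hZ; case: m => w; elim: w => [|g w IH].
  suff <- : 1 = mon (FMonom [::]) by [].
  by congr mkmalgU; apply/eqP; rewrite fmP fm1.
suff -> : mon (FMonom (g :: w)) = freegen k g * mon (FMonom w) by apply: hG.
rewrite [RHS]malgU_mul mulr1; congr mkmalgU; apply/eqP.
by rewrite fmP fmM fmU.
Qed.
End FreeAlgebraTheory.

#[short(type="comPzAlgType")]
HB.structure Definition ComPzAlgebra (k : pzRingType) :=
  {A of GRing.ComNzRing A & isPzAlgebra k A}.

Section CommutativeMonoidAlgebra.
Variables (k : comNzRingType) (n : nat).

Definition cmalg : Type := {malg k[{cmonom 'I_n}]}.
HB.instance Definition _ := GRing.ComNzRing.on cmalg.

Definition cmalg_scal (c : k) : cmalg := c%:MP.
Lemma cmalg_scal_zmod : zmod_morphism cmalg_scal.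
Proof. by move=> c d; rewrite /cmalg_scal raddfB. Qed.
Lemma cmalg_scal_monoid : monoid_morphism cmalg_scal.
Proof. by split=> [|c d]; rewrite /cmalg_scal ?rmorph1 ?rmorphM. Qed.
Lemma cmalg_scalC (c : k) (a : cmalg) : cmalg_scal c * a = a * cmalg_scal c.
Proof. exact: mulrC. Qed.
HB.instance Definition _ :=
  isPzAlgebra.Build k cmalg cmalg_scal_zmod cmalg_scal_monoid cmalg_scalC.

Definition cmvar (i : 'I_n) : cmalg := @mkmalgU {cmonom 'I_n} k (@ucm 'I_n i) 1.

Definition cmprod (m : {cmonom 'I_n}) : {cmonom 'I_n} :=
  \big[mmul/mone]_i iter (m i) (mmul (@ucm 'I_n i)) mone.

Lemma iter_ucmE i j d : iter d (mmul (@ucm 'I_n i)) mone j = (d * (i == j))%N.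
Proof.
elim: d => [|d IH]; first by rewrite /= cm1.
by rewrite iterS cmM IH cmU mulSn.
Qed.

Lemma cmprodE m : cmprod m = m.
Proof.
apply/eqP/cmP => j; rewrite /cmprod.
have -> : (\big[mmul/mone]_i iter (m i) (mmul (@ucm 'I_n i)) mone) j
    = (\sum_i iter (m i) (mmul (@ucm 'I_n i)) mone j)%N.
  by apply: (big_morph (fun m : {cmonom 'I_n} => m j)) => [x z|]; rewrite ?cmM ?cm1.
rewrite (bigD1 j) //= big1 ?addn0 ?iter_ucmE ?eqxx ?muln1 // => i /negbTE ne.
by rewrite iter_ucmE ne muln0.
Qed.

Lemma cmalg_monom (c : k) m :
  (@mkmalgU {cmonom 'I_n} k m c : cmalg) = scal c * \prod_i cmvar i ^+ m i.
Proof.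
have malgUX i d : (@mkmalgU {cmonom 'I_n} k (iter d (mmul (@ucm 'I_n i)) mone) 1 :
  cmalg) = cmvar i ^+ d.
  elim: d => [|d IH]; first by rewrite expr0.
  by rewrite iterS exprS -IH [RHS]malgU_mul mulr1.
have -> : \prod_i cmvar i ^+ m i = (@mkmalgU {cmonom 'I_n} k m 1 : cmalg).
  rewrite -{2}(cmprodE m) /cmprod.
  rewrite (big_morph (fun m : {cmonom 'I_n} => @mkmalgU {cmonom 'I_n} k m 1 : cmalg)
    (id1 := 1) (op1 := *%R)) //.
    by apply: eq_bigr => i _; rewrite malgUX.
  by move=> x z; rewrite [RHS]malgU_mul mulr1.
by rewrite [RHS]malgU_mul mulr1 mul1m.
Qed.

Lemma cmalg_morph_eq (B : pzRingType) (f g : {rmorphism cmalg -> B}) :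
  (forall c, f (scal c) = g (scal c)) -> (forall i, f (cmvar i) = g (cmvar i)) ->
  f =1 g.
Proof.
move=> hc hX u; rewrite [u]monalgE !raddf_sum; apply: eq_bigr => m _.
rewrite /= cmalg_monom !rmorphM hc !rmorph_prod; congr (_ * _).
by apply: eq_bigr => i _; rewrite !rmorphXn hX.
Qed.

Lemma cmalg_univ (B : comPzRingType) (f : {rmorphism k -> B}) (X : 'I_n -> B) :
  {Psi : {rmorphism cmalg -> B} |
    (forall c, Psi (scal c) = f c) /\ forall i, Psi (cmvar i) = X i}.
Proof.
pose H (m : {cmonom 'I_n}) := \prod_i X i ^+ m i.
have [|m m'|c m|Psi hPsi] := @malg_univ k {cmonom 'I_n} B f H.
- by rewrite /H big1 // => i _; rewrite cm1.
- by rewrite /H -big_split; apply: eq_bigr => i _; rewrite cmM exprD.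
- exact: mulrC.
exists Psi; split=> [c|i].
  by rewrite [LHS]hPsi /H big1 ?mulr1 // => i _; rewrite cm1.
rewrite [LHS]hPsi rmorph1 mul1r /H (bigD1 i) //= cmUU big1 ?mulr1 // => j nij.
by rewrite cmU eq_sym (negbTE nij).
Qed.
End CommutativeMonoidAlgebra.

Section PolynomialRing.
Variables (k : comNzRingType) (n : nat).

(** The polynomial ring enters the proof only through the existence and the
uniqueness of the morphisms out of it. *)
Record poly_ring := PolyRing {
  poly_ring_sort : comPzAlgType k;
  poly_ring_var : 'I_n -> poly_ring_sort;
  poly_ring_univ : forall (B : comPzRingType) (f : {rmorphism k -> B}) (X : 'I_n -> B),
    {Psi : {rmorphism poly_ring_sort -> B} |
      (forall c, Psi (scal c) = f c) /\ forall i, Psi (poly_ring_var i) = X i};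
  poly_ring_eq : forall (B : pzRingType) (f g : {rmorphism poly_ring_sort -> B}),
    (forall c, f (scal c) = g (scal c)) ->
    (forall i, f (poly_ring_var i) = g (poly_ring_var i)) -> f =1 g
}.

Lemma poly_ring_exists : poly_ring.
Proof.
exact: (@PolyRing (cmalg k n) (@cmvar k n) (@cmalg_univ k n) (@cmalg_morph_eq k n)).
Qed.

Definition polyR : comPzAlgType k := poly_ring_sort poly_ring_exists.
Definition varX : 'I_n -> polyR := @poly_ring_var poly_ring_exists.

Lemma polyR_univ (B : comPzRingType) (f : {rmorphism k -> B}) (X : 'I_n -> B) :
  {Psi : {rmorphism polyR -> B} |
    (forall c, Psi (scal c) = f c) /\ forall i, Psi (varX i) = X i}.
Proof. exact: poly_ring_univ. Qed.

Lemma polyR_morph_eq (B : pzRingType) (f g : {rmorphism polyR -> B}) :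
  (forall c, f (scal c) = g (scal c)) -> (forall i, f (varX i) = g (varX i)) ->
  f =1 g.
Proof. exact: poly_ring_eq. Qed.
End PolynomialRing.

Section QuotientMap.
Variables (A B : pzRingType) (R : A -> Prop) (Psi : {rmorphism A -> B}).
Hypothesis hR : forall a, R a -> Psi a = 0.

Lemma idealquot_univ : exists Psi' : {rmorphism idealquot R -> B},
  forall a, Psi' (quot_pi R a) = Psi a.
Proof.
have ker a : in_ideal R a -> Psi a = 0.
  elim=> {a} [a /hR //||a b _ ea _ eb|c a _ e|c a _ e].
  - exact: rmorph0.
  - by rewrite rmorphB ea eb subrr.
  - by rewrite rmorphM e mulr0.
  - by rewrite rmorphM e mul0r.
pose F (u : idealquot R) := Psi (generic_quotient.repr u).
have FE a : F (quot_pi R a) = Psi a.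
  apply/eqP; rewrite -subr_eq0 -rmorphB; apply/eqP/ker/quot_pi_eq.
  by rewrite quot_pi_repr.
have Fz : zmod_morphism F.
  move=> u v; have [a <-] := quot_pi_surj u; have [b <-] := quot_pi_surj v.
  by rewrite -rmorphB !FE rmorphB.
have Fm : monoid_morphism F.
  split=> [|u v]; first by rewrite FE rmorph1.
  have [a <-] := quot_pi_surj u; have [b <-] := quot_pi_surj v.
  by rewrite -rmorphM !FE rmorphM.
pose z := GRing.isZmodMorphism.Build (idealquot R) B F Fz.
pose m := GRing.isMonoidMorphism.Build (idealquot R) B F Fm.
pose Psi' : {rmorphism idealquot R -> B} := HB.pack F z m.
by exists Psi' => a; apply: FE.
Qed.
End QuotientMap.

(** * The polynomials of the crossings *)

Section Eval2.
Variables (k : fieldType) (A : pzAlgType k).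

Lemma eval2_rmorph (B : pzRingType) (f : {rmorphism A -> B}) (Q : {poly {poly k}}) a b :
  f (eval2 Q a b) = \sum_(p < size Q) \sum_(q < size Q`_p)
     f (scal Q`_p`_q) * (f a ^+ p * f b ^+ q).
Proof.
rewrite /eval2 rmorph_sum; apply: eq_bigr => p _; rewrite rmorph_sum.
by apply: eq_bigr => q _; rewrite !rmorphM !rmorphXn.
Qed.

Lemma eval2_wide N (Q : {poly {poly k}}) (a b : A) :
  (size Q <= N)%N -> (forall p, (size (Q`_p)%R <= N)%N) ->
  eval2 Q a b = \sum_(p < N) \sum_(q < N) scal Q`_p`_q * (a ^+ p * b ^+ q).
Proof.
move=> h1 h2; rewrite /eval2 (big_ord_widen _ (fun p => \sum_(q < size Q`_p)
     scal Q`_p`_q * (a ^+ p * b ^+ q)) h1) big_mkcond; apply: eq_bigr => p _.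
case: ltnP => hp; last first.
  have -> : Q`_p = 0 by apply: nth_default.
  by rewrite big1 // => q _; rewrite coef0 raddf0 mul0r.
rewrite (big_ord_widen _ (fun q => scal Q`_p`_q * (a ^+ p * b ^+ q)) (h2 p)).
rewrite big_mkcond; apply: eq_bigr => q _.
case: ltnP => // hq; have -> : (Q`_p)`_q = 0 by apply: nth_default.
by rewrite raddf0 mul0r.
Qed.

Lemma eval2_swap (Q : {poly {poly k}}) (a b : A) : GRing.comm a b ->
  eval2 (swapXY Q) a b = eval2 Q b a.
Proof.
move=> ab; pose N := maxn (maxn (size Q) (sizeY Q)) (maxn (size (swapXY Q)) (sizeY
  (swapXY Q))).
rewrite !(@eval2_wide N) => [||p||p].
- rewrite exchange_big; apply: eq_bigr => p _; apply: eq_bigr => q _.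
  by rewrite coef_swapXY (commrX _ (commr_sym (commrX _ (commr_sym ab)))).
- by rewrite /N !leq_max leqnn ?orbT.
- by apply: leq_trans (max_size_coefXY _ _) _; rewrite /N !leq_max leqnn ?orbT.
- by rewrite /N !leq_max leqnn ?orbT.
- by apply: leq_trans (max_size_coefXY _ _) _; rewrite /N !leq_max leqnn ?orbT.
Qed.
End Eval2.

Section ColouredVariables.
Variables (k : comNzRingType) (n : nat).

Lemma isolate_univ (c : 'I_n) :
  {Phi : {rmorphism polyR k n -> {poly polyR k n}} |
    (forall d, Phi (scal d) = (scal d : polyR k n)%:P) /\
    forall a, Phi (varX k a) = if a == c then 'X else (varX k a)%:P}.
Proof.
exact: (@polyR_univ k n {poly polyR k n} (polyC \o @scal k (polyR k n))).
Qed.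

Definition isolate c := sval (isolate_univ c).

Lemma isolate_scal c d : isolate c (scal d) = (scal d : polyR k n)%:P.
Proof. exact: (proj1 (svalP (isolate_univ c))). Qed.

Lemma isolate_varX c a : isolate c (varX k a) = if a == c then 'X else (varX k a)%:P.
Proof. exact: (proj2 (svalP (isolate_univ c))). Qed.

Lemma isolateK c u : (isolate c u).[varX k c] = u.
Proof.
apply: (@polyR_morph_eq _ _ _ (horner_eval (varX k c) \o isolate c) idfun) => [d|a] /=.
  by rewrite isolate_scal /horner_eval hornerC.
by rewrite isolate_varX /horner_eval; case: eqP => [->|_]; rewrite ?hornerX ?hornerC.
Qed.
End ColouredVariables.

Section Colours.
Variables (I : finType) (C : cartan_datum I) (k : fieldType).
Variables (Q : I -> I -> {poly {poly k}}) (hQ : klr_polys C Q).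
Variables (n : nat) (i : n.-tuple I) (hi : uniq i) (L : wlat C).
Local Notation S := (polyR k n).
Local Notation X a := (varX k (a : 'I_n)).

Definition qpoly (a b : 'I_n) : S := eval2 (Q (tnth i a) (tnth i b)) (X a) (X b).
Definition ypoly (a : 'I_n) : S := X a ^+ `|scoroot C (tnth i a) L|%N.

Lemma qpoly_sym a b : qpoly a b = qpoly b a.
Proof. rewrite /qpoly (klrQ_sym hQ) eval2_swap; [by [] | exact: mulrC]. Qed.

Lemma ypoly_lead a : unitlead (@isolate k n a (ypoly a)).
Proof.
by rewrite /ypoly rmorphXn isolate_varX eqxx; apply: unitleadXn; apply: unitleadX.
Qed.

Lemma ypoly_free a c : a != c -> freeof (@isolate k n) c (ypoly a).
Proof.
by move=> /negbTE h; rewrite /freeof /ypoly rmorphXn isolate_varX h rmorphXn.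
Qed.

Lemma qpoly_free a b c : a != c -> b != c -> freeof (@isolate k n) c (qpoly a b).
Proof.
move=> /negbTE ha /negbTE hb; rewrite /freeof /qpoly (eval2_rmorph (@isolate k n c)).
rewrite [RHS](eval2_rmorph (polyC : {rmorphism S -> {poly S}}));
  apply: eq_bigr => p _; apply: eq_bigr => r _.
by rewrite /= isolate_scal !isolate_varX ha hb.
Qed.

(** By homogeneity the exponent of the first variable in [Q] is at most
[- cmat a b], and at this value the other exponent vanishes; so the leading
coefficient in [X a] is the constant that is nonzero by assumption. *)
Lemma qpoly_lead a b : a != b -> unitlead (@isolate k n a (qpoly a b)).
Proof.
move=> nab; pose ca := tnth i a; pose cb := tnth i b.
have nc : ca != cb by rewrite (inj_eq (tuple_uniqP _ hi)).
pose m := `|cmat C ca cb|%N.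
have c0 p r : (m < p)%N || ((p == m) && (0 < r)%N) -> (Q ca cb)`_p`_r = 0.
  move=> hpr; apply: (klrQ_homog hQ nc); apply/eqP; rewrite /root_form !cmat_diag.
  have da := symz_gt0 C ca; have db := symz_gt0 C cb; have le := cmat_le0 C nc.
  have em : cmat C ca cb = - m%:Z by rewrite /m; lia.
  rewrite em; case/orP: hpr => [h|/andP[/eqP-> h]]; nia.
have lead0 := klrQ_lead hQ nc; rewrite -/m in lead0.
have e r : (@isolate k n a (qpoly a b))`_r =
   \sum_(p < size (Q ca cb)) \sum_(q < size (Q ca cb)`_p)
     (scal (Q ca cb)`_p`_q * X b ^+ q) * (r == p :> nat)%:R.
  rewrite /qpoly eval2_rmorph coef_sum; apply: eq_bigr => p _.
  rewrite coef_sum; apply: eq_bigr => q _.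
  rewrite isolate_scal !isolate_varX eqxx eq_sym (negbTE nab).
  by rewrite coefCM -rmorphXn coefMC coefXn -mulrA [_%:R * _]mulrC.
exists m => [|r hr]; last first.
  rewrite e big1 // => p _; rewrite big1 // => q _.
  case: eqP => [er|]; last by rewrite mulr0.
  have hp : (m < p)%N by rewrite -er.
  by rewrite (c0 p q) ?raddf0 ?mul0r // hp.
have hm : (m < size (Q ca cb))%N.
  rewrite ltnNge; apply: contra lead0 => h.
  have -> : (Q ca cb)`_m = 0 by apply: nth_default.
  by rewrite coef0.
have hm0 : (0 < size ((Q ca cb)`_m)%R)%N.
  by rewrite lt0n; apply: contra lead0 => /eqP h; rewrite nth_default // h.
exists (scal ((Q ca cb)`_m`_0)^-1).
rewrite e (bigD1 (Ordinal hm)) //= [W in _ + W]big1 ?addr0; last first.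
  move=> p np; rewrite big1 // => q _.
  by rewrite -[m == p]/(Ordinal hm == p :> nat) eq_sym val_eqE (negbTE np) mulr0.
rewrite (bigD1 (Ordinal hm0)) //= big1 ?addr0.
  by rewrite eqxx !mulr1 -rmorphM divff // rmorph1.
move=> q nq; rewrite c0 ?raddf0 ?mul0r // eqxx lt0n orbC.
by rewrite -[nat_of_ord q == 0%N]/(q == Ordinal hm0) nq.
Qed.
End Colours.

(** * KLR relations indexed by permutations *)

Lemma center_mulC (A : pzRingType) : commutative (@GRing.mul 'Z[A]).
Proof. by move=> u v; apply: val_inj; have /centerP := valP u; apply. Qed.
HB.instance Definition _ (A : pzRingType) :=
  GRing.PzRing_hasCommutativeMul.Build 'Z[A] (@center_mulC A).

Section PermKLR.
Variables (k : fieldType) (n : nat) (A : pzAlgType k).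
Variables (Qc : 'I_n -> 'I_n -> {poly {poly k}}).
Variables (e : 'S_n -> A) (x : 'I_n -> A) (t : 'I_n.-1 -> A).
Local Notation S := (polyR k n).

(** What the KLR relations become when the idempotents are indexed by
permutations of distinct colours, together with the fact that [e], [x] and [t]
generate [A]. *)
Record perm_klr : Prop := PermKLR {
  pklr_ee : forall s s', e s * e s' = if s == s' then e s else 0;
  pklr_e1 : \sum_s e s = 1;
  pklr_xx : forall i j, x i * x j = x j * x i;
  pklr_xe : forall i s, x i * e s = e s * x i;
  pklr_te : forall l s, t l * e s = e (swap l s) * t l;
  pklr_tx : forall l i, t l * x i = x (simple_transp l i) * t l;
  pklr_tt : forall l m : 'I_n.-1, (l.+1 < m)%N || (m.+1 < l)%N -> t l * t m = t m * t l;
  pklr_t2 : forall l s, t l * t l * e s =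
    eval2 (Qc (s (posl l)) (s (posr l))) (x (posl l)) (x (posr l)) * e s;
  pklr_braid : forall l m : 'I_n.-1, m = l.+1 :> nat ->
    t m * t l * t m = t l * t m * t l;
  pklr_ind : forall P : A -> Prop, P 1 -> (forall a b, P a -> P b -> P (a + b)) ->
    (forall c a, P a -> P (scal c * a)) -> (forall s a, P a -> P (e s * a)) ->
    (forall j a, P a -> P (x j * a)) -> (forall l a, P a -> P (t l * a)) ->
    forall a, P a
}.
Hypothesis H : perm_klr.

(** This is the dot on the strand of label [a], wherever that strand is. *)
Definition colX a : A := \sum_s x (place s a) * e s.

Lemma colXe a s : colX a * e s = x (place s a) * e s.
Proof.
rewrite /colX mulr_suml (bigD1 s) //= big1 ?addr0 -?mulrA ?pklr_ee ?eqxx //.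
by move=> s' ns; rewrite -mulrA (pklr_ee H) (negbTE ns) mulr0.
Qed.

Lemma e_colX a s : e s * colX a = x (place s a) * e s.
Proof.
rewrite /colX mulr_sumr (bigD1 s) //= big1 ?addr0 => [|s' ns].
  by rewrite mulrA -(pklr_xe H) -mulrA (pklr_ee H) eqxx.
by rewrite mulrA -(pklr_xe H) -mulrA (pklr_ee H) eq_sym (negbTE ns) mulr0.
Qed.

(** A crossing carries the strand of label [a] along with its dot. *)
Lemma colX_central a : colX a \in center A.
Proof.
apply/centerP; apply: (pklr_ind H) => [|b c hb hc|c b hb|s b hb|j b hb|l b hb].
- by rewrite mulr1 mul1r.
- by rewrite mulrDr mulrDl hb hc.
- by rewrite mulrA -scalC -!mulrA hb.
- by rewrite mulrA colXe -e_colX -!mulrA hb.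
- rewrite -[RHS]mulrA -hb !mulrA; congr (_ * b).
  rewrite /colX mulr_suml mulr_sumr; apply: eq_bigr => s _.
  by rewrite -mulrA -(pklr_xe H) !mulrA (pklr_xx H).
- rewrite -[RHS]mulrA -hb !mulrA; congr (_ * b).
  rewrite /colX mulr_suml mulr_sumr (reindex_inj (inv_inj (swapK l))).
  apply: eq_bigr => s _.
  by rewrite mulrA (pklr_tx H) -!mulrA (pklr_te H) place_swap.
Qed.

Definition phi_sig :=
  @polyR_univ k n 'Z[A] (@scal k 'Z[A]) (fun a => CenterElt (colX_central a)).
Definition phiZ : {rmorphism S -> 'Z[A]} := sval phi_sig.
Definition phi (f : S) : A := center_val (phiZ f).

Lemma phi_zmod : zmod_morphism phi.
Proof. by move=> f g; rewrite /phi rmorphB. Qed.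
HB.instance Definition _ := GRing.isZmodMorphism.Build S A phi phi_zmod.
Lemma phi_monoid : monoid_morphism phi.
Proof. by split=> [|f g]; rewrite /phi ?rmorph1 ?rmorphM. Qed.
HB.instance Definition _ := GRing.isMonoidMorphism.Build S A phi phi_monoid.

Lemma phi_scal c : phi (scal c) = scal c.
Proof. by rewrite /phi /phiZ (proj1 (svalP phi_sig)). Qed.

Lemma phi_varX a : phi (varX k a) = colX a.
Proof. by rewrite /phi /phiZ (proj2 (svalP phi_sig)). Qed.

Lemma phiC f b : phi f * b = b * phi f.
Proof. by have /centerP := valP (phiZ f); apply. Qed.

Lemma x_e j s : x j * e s = phi (varX k (s j)) * e s.
Proof. by rewrite phi_varX colXe permK_place. Qed.

Lemma xX_e j s m : x j ^+ m * e s = phi (varX k (s j) ^+ m) * e s.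
Proof.
elim: m => [|m IH]; first by rewrite !expr0 rmorph1.
by rewrite exprSr -mulrA x_e mulrA -phiC -mulrA IH mulrA -rmorphM -exprS.
Qed.

Lemma eval2_e (q : {poly {poly k}}) i j s : eval2 q (x i) (x j) * e s =
  phi (eval2 q (varX k (s i)) (varX k (s j))) * e s.
Proof.
rewrite (eval2_rmorph phi) /eval2 !mulr_suml; apply: eq_bigr => p _.
rewrite !mulr_suml; apply: eq_bigr => r _.
rewrite /= phi_scal -!mulrA; congr (_ * _); rewrite !mulrA -!rmorphXn.
rewrite -mulrA xX_e mulrA -phiC -mulrA xX_e !mulrA -!rmorphM.
by congr (phi _ * _); apply: mulrC.
Qed.

Lemma sum_e a : a = \sum_s e s * a.
Proof. by rewrite -mulr_suml (pklr_e1 H) mul1r. Qed.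

Definition swap_poly l (s : 'S_n) : S :=
  eval2 (Qc (s (posl l)) (s (posr l))) (varX k (s (posl l))) (varX k (s (posr l))).

Lemma tt_e l s : t l * t l * e s = phi (swap_poly l s) * e s.
Proof. by rewrite (pklr_t2 H) eval2_e. Qed.

(** Crossings are extended by [1] to all natural indices so that words of
crossings can be written as products over intervals. *)
Definition tau_at (r : nat) : A := if insub r is Some l then t l else 1.
Definition swap_at (r : nat) (s : 'S_n) := if insub r is Some l then swap l s else s.

Lemma tau_atE (l : 'I_n.-1) : tau_at l = t l.
Proof. by rewrite /tau_at valK. Qed.

(** This word slides the strand at place [m] to place [j]; the words
[slide_word n.-1 j1 * slide_word n.-2 j2 * ..] give one reduced expression for
each permutation. *)
Definition slide_word (m j : nat) : A := \prod_(j <= r < m) tau_at r.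
Definition slide_perm (m j : nat) s := foldl (fun s r => swap_at r s) s (index_iota j
  m).

Lemma slide_word_id m : slide_word m m = 1.
Proof. by rewrite /slide_word big_geq. Qed.

Lemma e_slide_word s m j : e s * slide_word m j = slide_word m j * e (slide_perm m j s).
Proof.
rewrite /slide_word /slide_perm; elim: (index_iota j m) s => [|r w IH] s.
  by rewrite big_nil mulr1 mul1r.
rewrite big_cons /= mulrA -[RHS]mulrA -IH [RHS]mulrA; congr (_ * _).
rewrite /tau_at /swap_at; case: insub => [l|]; last by rewrite mulr1 mul1r.
by rewrite (pklr_te H) swapK.
Qed.

Lemma slide_permS m j s : (j <= m)%N ->
  slide_perm m.+1 j s = swap_at m (slide_perm m j s).
Proof.
by move=> h; rewrite /slide_perm /index_iota subSn // -addn1 iotaD foldl_cat /= subnKC.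
Qed.

Lemma slide_perm_high m j s (i : 'I_n) : (j <= m)%N -> (m < i)%N ->
  slide_perm m j s i = s i.
Proof.
move=> /subnKC <-; elim: (m - j)%N => [|d IH];
  first by rewrite addn0 /slide_perm /index_iota subnn.
rewrite addnS => hi; rewrite slide_permS ?leq_addr // /swap_at;
  case: insubP => [l _ el|_]; last exact/IH/ltnW.
have ei : simple_transp l i = i.
  by apply: val_inj; rewrite /= val_transp el !gtn_eqF // ltnW.
by rewrite swapE ei; apply/IH/ltnW.
Qed.

Lemma slide_perm_top m j s (i i' : 'I_n) : (j <= m)%N -> i = m :> nat ->
  i' = j :> nat ->
  slide_perm m j s i = s i'.
Proof.
move=> /subnKC <-; elim: (m - j)%N i => [|d IH] i.
  rewrite addn0 /slide_perm /index_iota subnn /= => ei ei'.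
  by rewrite (_ : i = i') //; apply: val_inj; rewrite /= ei ei'.
rewrite addnS => ei ei'; rewrite slide_permS ?leq_addr // /swap_at.
case: insubP => [l _ el|]; last first.
  by move=> /negP[]; have := ltn_ord i; rewrite ei; lia.
have hi : (j + d < n)%N by rewrite -el; exact: leq_trans (ltn_ord l) (leq_pred n).
have ej : simple_transp l i = Ordinal hi.
  by apply: val_inj; rewrite /= val_transp el ei gtn_eqF // eqxx.
by rewrite swapE ej; apply: IH.
Qed.

(** [spanned m] is the [phi S]-span of the normal forms that permute the first [m]
places only. *)
Inductive spanned : nat -> A -> Prop :=
| spanned_base f s : spanned 0 (phi f * e s)
| spanned_add m a b of spanned m a & spanned m b : spanned m (a + b)
| spanned_step m j a of (j <= m)%N & (m < n)%N & spanned m a : spanned m.+1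
  (slide_word m j * a).

Lemma spanned_lift m m' a : (m <= m')%N -> (m' <= n)%N -> spanned m a -> spanned m' a.
Proof.
move=> /subnKC <-; elim: (m' - m)%N => [|d IH]; first by rewrite addn0.
rewrite addnS => h ha; rewrite -[a]mul1r -(slide_word_id (m + d)).
by apply: spanned_step => //; apply: IH => //; apply: ltnW.
Qed.

Lemma spanned_phi m f a : spanned m a -> spanned m (phi f * a).
Proof.
elim=> {m a} [g s|m a b _ ha _ hb|m j a hj hm _ ha].
- by rewrite mulrA -rmorphM; apply: spanned_base.
- by rewrite mulrDr; apply: spanned_add.
- by rewrite mulrA phiC -mulrA; apply: spanned_step.
Qed.

Lemma spanned0 m a : spanned m a -> spanned m 0.
Proof. by move=> /(spanned_phi 0); rewrite rmorph0 mul0r. Qed.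

Lemma spanned_sum m (a : 'S_n -> A) : (forall s, spanned m (a s)) ->
  spanned m (\sum_s a s).
Proof.
move=> h; apply: big_ind => //; last by move=> u v; apply: spanned_add.
exact: spanned0 (h 1%g).
Qed.

Lemma spanned_e m s a : spanned m a -> spanned m (e s * a).
Proof.
move=> h; elim: h s => {m a} [f s'|m a b _ ha _ hb|m j a hj hm _ ha] s.
- rewrite mulrA -phiC -mulrA (pklr_ee H); case: eqP => _; first exact: spanned_base.
  by rewrite mulr0 -(mul0r (e s)) -(rmorph0 phi); apply: spanned_base.
- by rewrite mulrDr; apply: spanned_add.
- by rewrite mulrA e_slide_word -mulrA; apply: spanned_step.
Qed.

Lemma t_slide_word (l : 'I_n.-1) m j :
  (forall r, (j <= r)%N -> (r < m)%N -> (l.+1 < r)%N || (r.+1 < l)%N) ->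
  t l * slide_word m j = slide_word m j * t l.
Proof.
rewrite /slide_word => h; rewrite big_seq;
  apply: (big_ind (fun u => t l * u = u * t l)).
- by rewrite mulr1 mul1r.
- by move=> u v hu hv; rewrite mulrA hu -mulrA hv mulrA.
move=> r; rewrite mem_index_iota => /andP[/h hr /hr]; rewrite /tau_at.
case: insubP => [l' _ <-|_ _]; last by rewrite mulr1 mul1r.
exact: (pklr_tt H).
Qed.

(** Left multiplication by a crossing preserves the normal forms: according to the
position of [l] with respect to [j], the crossing passes through
[slide_word m j], lengthens it, is absorbed by a square, or passes through it by
one braid move and becomes the crossing [l.-1]. *)
Lemma spanned_t m (l : 'I_n.-1) a : (l.+1 < m)%N -> spanned m a -> spanned m (t l * a).
Proof.
move=> hl h; elim: h l hl => {m a} [//|m a b _ ha _ hb|m j a hj hm hA ha] l.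
  by move=> hl; rewrite mulrDr; apply: spanned_add; [apply: ha | apply: hb].
rewrite ltnS => hl; rewrite mulrA.
have [ltlj|] := ltnP l j.
  have [ltlj1|] := ltnP l.+1 j.
    rewrite t_slide_word => [|r hr _]; last by rewrite (leq_trans ltlj1).
    by rewrite -mulrA; apply: spanned_step => //; apply: ha; apply: leq_trans hj.
  rewrite leq_eqVlt ltnNge ltlj orbF => /eqP ej.
  have -> : t l * slide_word m j = slide_word m l by rewrite ej /slide_word
    [RHS]big_ltn // tau_atE.
  by apply: spanned_step => //; apply: ltnW.
rewrite leq_eqVlt => /orP[/eqP ->|ltjl].
  rewrite /slide_word big_ltn // tau_atE -/(slide_word m l.+1) !mulrA -mulrA
    [slide_word _ _ * a]sum_e.
  rewrite mulr_sumr; apply: spanned_sum => s; rewrite mulrA tt_e -mulrA.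
  by apply: spanned_phi; apply: spanned_e; apply: spanned_step.
have hl' : (l.-1 < n.-1)%N by apply: leq_ltn_trans (leq_pred _) (ltn_ord l).
have [l' el] : exists l' : 'I_n.-1, l = l'.+1 :> nat.
  by exists (Ordinal hl'); rewrite /= prednK //; apply: leq_ltn_trans ltjl.
have em : slide_word m j = slide_word l' j * (t l' * (t l * slide_word m l.+1)).
  have lem : (l' < m)%N by apply: leq_ltn_trans hl; rewrite el.
  have lej : (j <= l')%N by rewrite -ltnS -el.
  rewrite /slide_word (big_cat_nat lej (ltnW lem)) /=; congr (_ * _).
  by rewrite big_ltn // tau_atE -el big_ltn // tau_atE.
rewrite {1}em mulrA.
rewrite t_slide_word; last by move=> r _; rewrite /= -ltnS; lia.
have -> : slide_word l' j * t l * (t l' * (t l * slide_word m l.+1)) =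
          slide_word l' j * (t l' * (t l * slide_word m l.+1)) * t l'.
  rewrite -!mulrA; congr (_ * _).
  rewrite -[slide_word m l.+1 * _]t_slide_word; last by move=> r hr _; lia.
  by rewrite !mulrA (pklr_braid H el).
rewrite -em.
by rewrite -mulrA; apply: spanned_step => //; apply: ha; rewrite -el.
Qed.

Lemma spanned_all a : spanned n a.
Proof.
apply: (pklr_ind H) a => [|a b|c a|s a|j a|l a].
- rewrite -(pklr_e1 H); apply: spanned_sum => s; apply: (@spanned_lift 0) => //.
  by rewrite -[e s]mul1r -(rmorph1 phi); apply: spanned_base.
- exact: spanned_add.
- by rewrite -phi_scal; apply: spanned_phi.
- exact: spanned_e.
- move=> ha; rewrite [a]sum_e mulr_sumr; apply: spanned_sum => s.
  by rewrite mulrA x_e -mulrA; apply: spanned_phi; apply: spanned_e.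
- by apply: spanned_t; have := ltn_ord l; lia.
Qed.

(** A word that permutes the places nontrivially changes every sequence of
distinct labels, so only the trivial word contributes between [e s] and [e s].
The induction also tracks the corners [e s' * b * e s], which vanish when [s']
and [s] differ at a place that the words do not move. *)
Lemma diag_corner a s : exists f, e s * a * e s = phi f * e s.
Proof.
suff K m b : spanned m b ->
    (forall s' : 'S_n, (exists2 j : 'I_n, (m <= j)%N & s' j != s j) ->
      e s' * b * e s = 0) /\ exists f, e s * b * e s = phi f * e s.
  by have [] := K _ _ (spanned_all a).
elim=> {m a b} [f s0|m a b _ [ha [f hf]] _ [hb [g hg]]|m j a hj hm _ [ha hf]].
- split=> [s' [j _ nj]|].
    have ns : s' != s by apply: contra nj => /eqP->.
    rewrite mulrA -phiC -!mulrA (pklr_ee H s0).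
    case: eqP => [->|_]; last by rewrite !mulr0.
    by rewrite (pklr_ee H) (negbTE ns) mulr0.
  exists (if s == s0 then f else 0); rewrite mulrA -phiC -!mulrA (pklr_ee H s0).
  case: (eqVneq s0 s) => [->|_]; first by rewrite (pklr_ee H) eqxx.
  by rewrite !mulr0 rmorph0 mul0r.
- split=> [s' h|]; first by rewrite mulrDr mulrDl ha ?hb ?addr0.
  by exists (f + g); rewrite mulrDr mulrDl hf hg rmorphD mulrDl.
- have ec s' : e s' * (slide_word m j * a) * e s = slide_word m j * (e (slide_perm m
    j s') * a * e s).
    by rewrite mulrA e_slide_word -!mulrA.
  split=> [s' [i hi ni]|].
    rewrite ec ha ?mulr0 //; exists i; first exact: ltnW.
    by rewrite slide_perm_high.
  move: hj; rewrite leq_eqVlt => /orP[/eqP ej|ltjm].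
    by rewrite ec ej slide_word_id mul1r /slide_perm /index_iota subnn.
  exists 0; rewrite ec ha ?mulr0 ?rmorph0 ?mul0r //.
  have hjn := ltn_trans ltjm hm.
  exists (Ordinal hm) => //;
    rewrite (@slide_perm_top _ _ _ _ (Ordinal hjn)) ?(ltnW ltjm) //.
  by rewrite (inj_eq perm_inj) -val_eqE /= ltn_eqF.
Qed.

(** ** Central elements of a quotient *)

Section CentralLift.
Variables (B : pzRingType) (pi : {rmorphism A -> B}) (a : A) (F : 'S_n -> S).
Hypothesis pi_central : forall b, pi a * b = b * pi a.
Hypothesis cornerF : forall s, e s * a * e s = phi (F s) * e s.

Lemma pi_diag s : pi (a * e s) = pi (phi (F s) * e s).
Proof.
have ee : e s * e s = e s by rewrite (pklr_ee H) eqxx.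
by rewrite -cornerF !rmorphM -pi_central -mulrA -[pi (e s) * _]rmorphM ee.
Qed.

(** Commuting [pi a] with the crossing [t l * e s] compares the polynomials of
[s] and [swap l s]. *)
Lemma pi_crossing l s : pi (phi (F s - F (swap l s)) * (t l * e s)) = 0.
Proof.
rewrite rmorphB mulrBl rmorphB mulrA [phi (F s) * t l]phiC -mulrA rmorphM.
rewrite -pi_diag (pklr_te H) [phi (F _) * (e _ * t l)]mulrA.
rewrite [pi (_ * t l)]rmorphM -pi_diag -rmorphM -[a * _ * t l]mulrA -(pklr_te H).
by rewrite !rmorphM !mulrA pi_central subrr.
Qed.

Lemma pi_lift f : (forall s, pi (phi (f - F s) * e s) = 0) -> pi (phi f) = pi a.
Proof.
move=> h; rewrite -[phi f]mulr1 -[a]mulr1 -(pklr_e1 H) !mulr_sumr !rmorph_sum.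
apply: eq_bigr => s _; rewrite pi_diag; apply/eqP; rewrite -subr_eq0 -rmorphB.
by rewrite -mulrBl -rmorphB h.
Qed.
End CentralLift.

End PermKLR.

(** * Weight sequences as permutations of the labels *)

Section RelationTransport.
Variables (I : finType) (C : cartan_datum I) (k : fieldType).
Variables (Q : I -> I -> {poly {poly k}}) (n : nat) (beta : wlat C).
Variables (A B : pzAlgType k) (f : {rmorphism A -> B}).
Hypothesis f_scal : forall c, f (scal c) = scal c.
Variables (e : weight_seq n beta -> A) (x : 'I_n -> A) (t : 'I_n.-1 -> A).
Hypothesis hf : forall a b, klr_rel Q e x t a b -> f a = f b.

Lemma rmorph_eval2 q a b : f (eval2 q a b) = eval2 q (f a) (f b).
Proof.
rewrite eval2_rmorph; apply: eq_bigr => p _; apply: eq_bigr => r _.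
by rewrite f_scal.
Qed.

Lemma rmorph_divdiff q a b c : f (divdiff q a b c) = divdiff q (f a) (f b) (f c).
Proof.
rewrite /divdiff rmorph_sum; apply: eq_bigr => p _; rewrite rmorph_sum.
apply: eq_bigr => r _; rewrite !rmorphM f_scal rmorph_sum rmorphXn.
congr (_ * (_ * _)); apply: eq_bigr => j _; by rewrite rmorphM !rmorphXn.
Qed.

Lemma klr_rel_morph a b : klr_rel Q (f \o e) (f \o x) (f \o t) a b -> a = b.
Proof.
case=> [nu nu'||j j'|j nu|l nu|l m h|l nu|l j nu|l m nu h] /=.
- by rewrite -rmorphM (hf (klr_ee _ _ _ _ _ _)); case: eqP => // _; rewrite rmorph0.
- by rewrite -rmorph_sum (hf (klr_e1 _ _ _ _)) rmorph1.
- by rewrite -!rmorphM (hf (klr_xx _ _ _ _ _ _)).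
- by rewrite -!rmorphM (hf (klr_xe _ _ _ _ _ _)).
- by rewrite -!rmorphM (hf (klr_te _ _ _ _ _ _)).
- by rewrite -!rmorphM (hf (klr_tt _ _ _ _ h)).
- by rewrite -rmorph_eval2 -rmorphXn -!rmorphM (hf (klr_t2 _ _ _ _ _ _)).
- rewrite -!rmorphM -rmorphB -rmorphM (hf (klr_tx _ _ _ _ _ _ _)).
  by do 2?case: ifP => _; rewrite ?rmorphN ?rmorph0.
- rewrite -!rmorphM -rmorphB -rmorphM (hf (klr_braid _ _ _ _ _ h)).
  by case: ifP => _; rewrite ?rmorph0 // rmorphM rmorph_divdiff.
Qed.

Lemma klr_rel_image (e' : weight_seq n beta -> B) (x' : 'I_n -> B)
    (t' : 'I_n.-1 -> B) a b :
  (forall nu, f (e nu) = e' nu) -> (forall j, f (x j) = x' j) ->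
  (forall l, f (t l) = t' l) -> (forall a b, klr_rel Q e' x' t' a b -> a = b) ->
  klr_rel Q e x t a b -> f a = f b.
Proof.
move=> fe fx ft hB; case=> [nu nu'||j j'|j nu|l nu|l m h|l nu|l j nu|l m nu h].
- by rewrite rmorphM !fe (hB _ _ (klr_ee _ _ _ _ _ _)); case: eqP => // _;
    rewrite rmorph0.
- by rewrite rmorph_sum rmorph1 -(hB _ _ (klr_e1 _ _ _ _)); apply: eq_bigr.
- by rewrite !rmorphM !fx (hB _ _ (klr_xx _ _ _ _ _ _)).
- by rewrite !rmorphM !fx !fe (hB _ _ (klr_xe _ _ _ _ _ _)).
- by rewrite !rmorphM !ft !fe (hB _ _ (klr_te _ _ _ _ _ _)).
- by rewrite !rmorphM !ft (hB _ _ (klr_tt _ _ _ _ h)).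
- by rewrite rmorphM rmorphXn [in RHS]rmorphM rmorph_eval2 ft fe !fx (hB _ _ (klr_t2
    _ _ _ _ _ _)).
- rewrite rmorphM rmorphB !rmorphM fe ft !fx (hB _ _ (klr_tx _ _ _ _ _ _ _)).
  by do 2?case: ifP => _; rewrite ?rmorphN ?fe ?rmorph0.
- rewrite rmorphM rmorphB !rmorphM fe !ft (hB _ _ (klr_braid _ _ _ _ _ h)).
  by case: ifP => _; rewrite ?rmorph0 // rmorphM rmorph_divdiff fe !fx.
Qed.
End RelationTransport.

Section Weights.
Variables (I : finType) (C : cartan_datum I) (k : fieldType).
Variables (Q : I -> I -> {poly {poly k}}) (n : nat) (i : n.-tuple I) (hi : uniq i).
Variables (beta : wlat C) (hbeta : beta = \sum_(j < n) sroot C (tnth i j)).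

Lemma sum_sroot (u : n.-tuple I) :
  \sum_(j < n) sroot C (tnth u j) = \sum_a sroot C a *~ (count_mem a u)%:Z.
Proof.
rewrite -(big_tuple _ _ u predT (sroot C)); elim: (tval u) => [|b w IH].
  by rewrite big_nil big1 // => a _; rewrite mulr0z.
rewrite big_cons IH (bigD1 b) //= [RHS](bigD1 b) //= eqxx addrA; congr (_ + _).
  by rewrite -[X in X + _]mulr1z -mulrzDr.
by apply: eq_bigr => a /negbTE nab; rewrite eq_sym nab.
Qed.

Lemma wt_proof (s : 'S_n) :
  \sum_(j < n) sroot C (tnth [tuple tnth i (s j) | j < n] j) == beta.
Proof.
rewrite hbeta [X in _ == X](reindex_inj (@perm_inj _ s)) /=; apply/eqP.
by apply: eq_bigr => j _; rewrite tnth_mktuple.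
Qed.

Definition wt (s : 'S_n) : weight_seq n beta :=
  Sub [tuple tnth i (s j) | j < n] (wt_proof s).

Lemma tnth_wt s j : tnth (val (wt s)) j = tnth i (s j).
Proof. by rewrite tnth_mktuple. Qed.

Lemma wt_inj : injective wt.
Proof.
move=> s s' ess; apply/permP => j; apply/(tuple_uniqP _ hi).
by rewrite -!tnth_wt ess.
Qed.

(** The simple roots are linearly independent, so a weight sequence of weight
[beta] uses each colour as often as [i] does. *)
Lemma wt_surj nu : exists s, wt s = nu.
Proof.
have: perm_eq (val nu) i.
  have h := etrans (eqP (valP nu)) hbeta; rewrite !sum_sroot in h.
  apply/allP => a _; apply/eqP.
  have := @sroot_free _ C (fun a => (count_mem a (val nu))%:Z - (count_mem a i)%:Z) _ a.
  move=> H; apply/eqP; rewrite -eqz_nat -subr_eq0; apply/eqP; apply: H.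
  under eq_bigr do rewrite mulrzBr.
  by rewrite sumrB h subrr.
case/tuple_permP => s es; exists s; apply: val_inj; apply: eq_from_tnth => j.
rewrite tnth_wt; have -> : val nu = [tuple tnth i (s j) | j < n] by apply: val_inj.
by rewrite tnth_mktuple.
Qed.

Lemma wt_bij : bijective wt.
Proof.
apply: inj_card_bij wt_inj _; rewrite -(card_codom wt_inj).
by apply/subset_leq_card/subsetP => nu _; have [s <-] := wt_surj nu; apply: codom_f.
Qed.

Lemma wt_act l s : weight_act (simple_transp l) (wt s) = wt (swap l s).
Proof.
apply: val_inj; apply: eq_from_tnth => j.
by rewrite tnth_wt /= tnth_mktuple tnth_mktuple swapE tpermV.
Qed.

Lemma wt_res_eq s j j' : (tnth (val (wt s)) j == tnth (val (wt s)) j') = (j == j').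
Proof. by rewrite !tnth_wt (inj_eq (tuple_uniqP _ hi)) (inj_eq perm_inj). Qed.

Lemma posl_neq (l : 'I_n.-1) : (posl l == posr l) = false.
Proof. by rewrite -val_eqE /= ltn_eqF. Qed.

Lemma sum_wt (V : nmodType) (F : weight_seq n beta ->
  V) : \sum_nu F nu = \sum_s F (wt s).
Proof. by rewrite (reindex wt) //; apply: onW_bij wt_bij. Qed.

Section PermForm.
Variables (A : pzAlgType k).
Variables (e : weight_seq n beta -> A) (x : 'I_n -> A) (t : 'I_n.-1 -> A).
Hypothesis hA : forall a b, klr_rel Q e x t a b -> a = b.
Hypothesis ind : forall P : A -> Prop, P 1 -> (forall a b, P a -> P b -> P (a + b)) ->
    (forall c a, P a -> P (scal c * a)) -> (forall nu a, P a -> P (e nu * a)) ->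
    (forall j a, P a -> P (x j * a)) -> (forall l a, P a -> P (t l * a)) ->
    forall a, P a.

Lemma sum_e_wt : \sum_s e (wt s) = 1.
Proof. by rewrite -sum_wt (hA (klr_e1 _ _ _ _)). Qed.

Lemma mul_e_inj (a b : A) : (forall s, a * e (wt s) = b * e (wt s)) -> a = b.
Proof.
by move=> h; rewrite -[a]mulr1 -[b]mulr1 -sum_e_wt !mulr_sumr; apply: eq_bigr.
Qed.

Lemma sum_mul_e (F : weight_seq n beta -> A) nu0 :
  (\sum_nu F nu * e nu) * e nu0 = F nu0 * e nu0.
Proof.
rewrite mulr_suml (bigD1 nu0) //= -mulrA (hA (klr_ee _ _ _ _ _ _)) eqxx big1 ?addr0 //.
by move=> nu /negbTE h; rewrite -mulrA (hA (klr_ee _ _ _ _ _ _)) h mulr0.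
Qed.

Lemma klr_rel_perm :
  perm_klr (fun a b => Q (tnth i a) (tnth i b)) (fun s => e (wt s)) x t.
Proof.
split.
- by move=> s s'; rewrite (hA (klr_ee _ _ _ _ _ _)) (inj_eq wt_inj).
- exact: sum_e_wt.
- by move=> a b; rewrite (hA (klr_xx _ _ _ _ _ _)).
- by move=> a s; rewrite (hA (klr_xe _ _ _ _ _ _)).
- by move=> l s; rewrite (hA (klr_te _ _ _ _ _ _)) wt_act.
- move=> l j; apply: mul_e_inj => s; apply/eqP; rewrite -subr_eq0 -mulrBl; apply/eqP.
  by rewrite (hA (klr_tx _ _ _ _ _ _ _)) wt_res_eq posl_neq !andbF.
- by move=> l m h; rewrite (hA (klr_tt _ _ _ _ h)).
- by move=> l s; rewrite -expr2 (hA (klr_t2 _ _ _ _ _ _)) !tnth_wt.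
- move=> l m h; apply: mul_e_inj => s; apply/eqP; rewrite -subr_eq0 -mulrBl; apply/eqP.
  by rewrite (hA (klr_braid _ _ _ _ _ h)) wt_res_eq -val_eqE /= h ltn_eqF.
- move=> P h1 hD hZ he hx ht; apply: ind => // nu a ha.
  by have [s <-] := wt_surj nu; apply: he.
Qed.
End PermForm.
End Weights.

(** * The presentation of the KLR algebra *)

Section KLRPresentation.
Variables (I : finType) (C : cartan_datum I) (k : fieldType).
Variables (Q : I -> I -> {poly {poly k}}) (n : nat) (beta : wlat C).
Local Notation K := (KLR Q n beta).

Lemma klr_relE (a b : K) :
  klr_rel Q (@klr_e _ C k Q n beta) (klr_x Q beta) (klr_t Q beta) a b -> a = b.
Proof.
apply: (@klr_rel_morph _ _ _ _ _ _ (klr_free k n beta) K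
   (quot_pi (@klr_relator _ C k Q n beta)) _ (@free_e _ C k n beta)
   (@free_x _ C k n beta) (@free_t _ C k n beta)).
- exact: quot_pi_scal.
- by move=> u v h; apply/quot_pi_eq; apply: in_ideal_gen; exists u, v.
Qed.

Lemma klr_ind (P : K -> Prop) :
  P 1 -> (forall a b, P a -> P b -> P (a + b)) ->
  (forall c a, P a -> P (scal c * a)) -> (forall nu a, P a -> P (klr_e Q nu * a)) ->
  (forall j a, P a -> P (klr_x Q beta j * a)) ->
  (forall l a, P a -> P (klr_t Q beta l * a)) -> forall a, P a.
Proof.
move=> h1 hD hZ he hx ht a; have [a' <-] := quot_pi_surj a.
elim/freealg_ind: a' => [|u v hu hv|c u hu|g u hu].
- by rewrite rmorph1.
- by rewrite rmorphD; apply: hD.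
- by rewrite rmorphM; exact: (hZ c _ hu).
- by rewrite rmorphM; case: g => [[nu|j]|l];
    [exact: (he nu _ hu)|exact: (hx j _ hu)|exact: (ht l _ hu)].
Qed.

Lemma klr_univ (B : pzAlgType k) (e : weight_seq n beta -> B) (x : 'I_n -> B)
    (t : 'I_n.-1 -> B) : (forall a b, klr_rel Q e x t a b -> a = b) ->
  exists Psi : {rmorphism K -> B}, [/\ forall c, Psi (scal c) = scal c,
    forall nu, Psi (klr_e Q nu) = e nu, forall j, Psi (klr_x Q beta j) = x j &
    forall l, Psi (klr_t Q beta l) = t l].
Proof.
move=> hB; pose h (g : klr_gen n beta) : B :=
  match g with inl (inl nu) => e nu | inl (inr j) => x j | inr l => t l end.
have [|Psi [Pc Pg]] := @freealg_univ k (klr_gen n beta) B (@scal k B) h.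
  by move=> c g; apply: scalC.
have [|Psi' hPsi'] := @idealquot_univ (klr_free k n beta) B
    (@klr_relator _ C k Q n beta) Psi.
  move=> a [b [c [hbc ->]]]; apply/eqP; rewrite rmorphB subr_eq0; apply/eqP.
  apply: (@klr_rel_image _ _ _ _ _ _ (klr_free k n beta) B Psi Pc _ _ _ e x t)
    hB hbc => [nu|j|l]; exact: Pg.
by exists Psi'; split=> [c|nu|j|l]; rewrite ?hPsi' ?Pc ?Pg //; exact: (hPsi' (scal c)).
Qed.

End KLRPresentation.

(** * Operators on functions of a finite type *)

Section MonomialMatrices.
Variables (k : fieldType) (T : finType) (S : comPzAlgType k).

Definition opalg : Type := 'M[S]_#|T|.
HB.instance Definition _ := GRing.PzRing.on opalg.

Definition opalg_scal (c : k) : opalg := (scal c : S)%:M.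
Lemma opalg_scal_zmod : zmod_morphism opalg_scal.
Proof. by move=> c d; rewrite /opalg_scal !raddfB. Qed.
Lemma opalg_scal_monoid : monoid_morphism opalg_scal.
Proof.
split=> [|c d]; first by rewrite /opalg_scal rmorph1.
by rewrite /opalg_scal rmorphM scalar_mxM.
Qed.
Lemma opalg_scalC (c : k) (a : opalg) : opalg_scal c * a = a * opalg_scal c.
Proof. by apply: esym; apply: scalar_mxC. Qed.
HB.instance Definition _ :=
  isPzAlgebra.Build k opalg opalg_scal_zmod opalg_scal_monoid opalg_scalC.

Implicit Types (f g : T -> T) (d : T -> S) (v : T -> S).

(** The operator that sends the basis vector of [s] to [d s] times that of
[f s]; all generators of the KLR algebra act in this way. *)
Definition monomx f d : opalg :=
  \matrix_(a, b) if enum_val a == f (enum_val b) then d (enum_val b) else 0.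

Lemma monomx_ext f g d d' : f =1 g -> d =1 d' -> monomx f d = monomx g d'.
Proof. by move=> ef ed; apply/matrixP => a b; rewrite !mxE ef ed. Qed.

Lemma sum_rank (F : T -> S) : \sum_(b < #|T|) F (enum_val b) = \sum_s F s.
Proof. by rewrite -(big_enum_val F); apply: eq_bigl => s; rewrite inE. Qed.

Lemma monomxM f g d d' :
  monomx f d * monomx g d' = monomx (f \o g) (fun s => d (g s) * d' s).
Proof.
apply/matrixP => a c; rewrite mxE [RHS]mxE /=.
pose F s := (if enum_val a == f s then d s else 0) *
  (if s == g (enum_val c) then d' (enum_val c) else 0).
rewrite (eq_bigr (fun b => F (enum_val b))) => [|b _]; last by rewrite !mxE.
rewrite sum_rank (bigD1 (g (enum_val c))) //= big1 ?addr0 => [|s /negbTE ns].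
  by rewrite /F eqxx; case: eqP => _; rewrite ?mul0r.
by rewrite /F ns mulr0.
Qed.

Lemma monomxB f d d' : monomx f d - monomx f d' = monomx f (fun s => d s - d' s).
Proof. by apply/matrixP => a b; rewrite !mxE; case: eqP; rewrite ?subr0. Qed.

Lemma monomx_sum (J : finType) f (d : J -> T -> S) :
  \sum_j monomx f (d j) = monomx f (fun s => \sum_j d j s).
Proof.
apply/matrixP => a b; rewrite summxE [RHS]mxE; case: eqP => e.
  by apply: eq_bigr => j _; rewrite mxE e eqxx.
by rewrite big1 // => j _; rewrite mxE; case: eqP.
Qed.

Lemma monomx0 f : monomx f (fun=> 0) = 0.
Proof. by apply/matrixP => a b; rewrite !mxE if_same. Qed.

Definition diagop d : opalg := monomx id d.

Lemma diagopM d d' : diagop d * diagop d' = diagop (fun s => d s * d' s).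
Proof. exact: monomxM. Qed.

Lemma diagop_cst (u : S) : diagop (fun=> u) = u%:M.
Proof.
apply/matrixP => a b; rewrite !mxE (inj_eq enum_val_inj).
by case: eqP; rewrite ?mulr1n ?mulr0n.
Qed.

Lemma diagop1 : diagop (fun=> 1) = 1.
Proof. by rewrite diagop_cst. Qed.

Lemma diagop_scal c : scal c = diagop (fun=> scal c).
Proof. by rewrite diagop_cst. Qed.

Lemma diagopX d m : diagop d ^+ m = diagop (fun s => d s ^+ m).
Proof.
elim: m => [|m IH]; first by rewrite expr0 -diagop1.
by rewrite exprS IH diagopM; apply: monomx_ext => // s; rewrite exprS.
Qed.

Lemma eval2_diagop q d d' :
  eval2 q (diagop d) (diagop d') = diagop (fun s => eval2 q (d s) (d' s)).
Proof.
rewrite /eval2 -[RHS]monomx_sum; apply: eq_bigr => p _.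
rewrite -[RHS]monomx_sum; apply: eq_bigr => r _.
by rewrite !diagopX diagopM diagop_scal diagopM.
Qed.

Definition cstop (u : S) : opalg := diagop (fun=> u).
Lemma cstop_zmod : zmod_morphism cstop.
Proof. by move=> u v; rewrite /cstop [RHS]monomxB. Qed.
HB.instance Definition _ := GRing.isZmodMorphism.Build S opalg cstop cstop_zmod.
Lemma cstop_monoid : monoid_morphism cstop.
Proof. by split=> [|u v]; rewrite /cstop ?diagop1 // [RHS]diagopM. Qed.
HB.instance Definition _ := GRing.isMonoidMorphism.Build S opalg cstop cstop_monoid.

Definition act (a : opalg) v : T -> S :=
  fun s => \sum_s' a (enum_rank s) (enum_rank s') * v s'.

Lemma actM a b v : act (a * b) v =1 act a (act b v).
Proof.
move=> s; rewrite /act.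
have E s' : (a * b) (enum_rank s) (enum_rank s') * v s' =
    \sum_s0 a (enum_rank s) (enum_rank s0) * (b (enum_rank s0) (enum_rank s') * v s').
  rewrite mxE mulr_suml.
  rewrite -(sum_rank (fun s0 => a (enum_rank s) (enum_rank s0) * (b (enum_rank s0)
    (enum_rank s') * v s'))).
  by apply: eq_bigr => c _; rewrite enum_valK mulrA.
rewrite (eq_bigr _ (fun s' _ => E s')) exchange_big; apply: eq_bigr => s0 _.
by rewrite mulr_sumr.
Qed.

Lemma actD a b v s : act (a + b) v s = act a v s + act b v s.
Proof. by rewrite /act -big_split; apply: eq_bigr => s' _; rewrite mxE mulrDl. Qed.

Lemma actB a b v s : act (a - b) v s = act a v s - act b v s.
Proof. by rewrite /act -sumrB; apply: eq_bigr => s' _; rewrite !mxE mulrBl. Qed.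

Lemma act0 v s : act 0 v s = 0.
Proof. by rewrite /act big1 // => s' _; rewrite mxE mul0r. Qed.

Lemma act_monomx f d v s : injective f -> act (monomx f d) v (f s) = d s * v s.
Proof.
move=> injf; rewrite /act (bigD1 s) //= big1 ?addr0 => [|s' ns].
  by rewrite mxE !enum_rankK eqxx.
by rewrite mxE !enum_rankK (inj_eq injf) eq_sym (negbTE ns) mul0r.
Qed.

Lemma act_diagop d v s : act (diagop d) v s = d s * v s.
Proof. exact: (@act_monomx id). Qed.

End MonomialMatrices.

(** * A representation adapted to a base permutation *)

Section SwapFacts.
Variable n : nat.
Implicit Types (s : 'S_n) (l m : 'I_n.-1).

Lemma swap_inj l : injective (swap l).
Proof. exact: inv_inj (swapK l). Qed.

Lemma swap_posl l s : swap l s (posl l) = s (posr l).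
Proof. by rewrite swapE tpermL. Qed.

Lemma swap_posr l s : swap l s (posr l) = s (posl l).
Proof. by rewrite swapE tpermR. Qed.

Lemma swap_else l s j : j != posl l -> j != posr l -> swap l s j = s j.
Proof. by move=> h1 h2; rewrite swapE tpermD // eq_sym. Qed.

Lemma swapC l m s : (l.+1 < m)%N || (m.+1 < l)%N ->
  swap l (swap m s) = swap m (swap l s).
Proof.
move=> h; apply/permP => j; rewrite !swapE; congr (s _).
apply: val_inj; rewrite /= !val_transp.
by do !case: eqP; lia.
Qed.

Lemma swap_braid l m s : m = l.+1 :> nat ->
  swap m (swap l (swap m s)) = swap l (swap m (swap l s)).
Proof.
move=> h; apply/permP => j; rewrite !swapE; congr (s _).
apply: val_inj; rewrite /= !val_transp h.
by do !case: eqP; lia.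
Qed.

Lemma before_swap_inv l s c b : b \in before (swap l s) c ->
  b \in before s c \/ b = s (posr l) /\ c = s (posl l).
Proof.
have [->|nc] := eqVneq c (s (posl l)); last first.
  have := @before_swap _ l (swap l s) c; rewrite swapK swap_posr => /(_ nc).
  by move=> /subsetP h /h; left.
have [->|nb] := eqVneq b (s (posr l)); first by right.
rewrite !inE !place_swap permK_place tpermL => h; left.
have : (place s b != posr l) by apply: contra nb => /eqP<-; rewrite placeK.
move: h; rewrite val_transp -val_eqE /=.
by do !case: eqP; lia.
Qed.

End SwapFacts.

Section Representation.
Variables (I : finType) (C : cartan_datum I) (k : fieldType).
Variables (Q : I -> I -> {poly {poly k}}) (hQ : klr_polys C Q).
Variables (n : nat) (i : n.-tuple I) (hi : uniq i).
Variables (beta : wlat C) (hbeta : beta = \sum_(j < n) sroot C (tnth i j)).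
Variables (L : wlat C) (mu : 'S_n).
Local Notation S := (polyR k n).
Local Notation vX := (@varX k n).
Local Notation wt := (wt hbeta).
Local Notation q := (qpoly Q i).
Local Notation y := (ypoly k i L).
Local Notation op := (opalg {perm 'I_n} S).
Local Notation diagop := (@diagop k {perm 'I_n} S).
Local Notation monomx := (@monomx k {perm 'I_n} S).

(** A crossing costs nothing when it takes two strands out of the order that they
have in [mu], and costs [q a b] when it restores this order. The two directions
multiply to [q a b], which is the quadratic relation, and the braid relation
holds because both sides cross the same three pairs. *)
Definition cross (a b : 'I_n) : S := if (place mu a < place mu b)%N then 1 else q a b.

Lemma crossM a b : a != b -> cross a b * cross b a = q a b.
Proof.
move=> nab; rewrite /cross; case: ltngtP => [_|_|/val_inj/place_inj/eqP].
- by rewrite mul1r (qpoly_sym hQ).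
- by rewrite mulr1.
- by rewrite (negbTE nab).
Qed.

Definition crossing l (s : 'S_n) : S := cross (s (posl l)) (s (posr l)).

Definition rep_e (nu : weight_seq n beta) : op := diagop (fun s => (wt s == nu)%:R).
Definition rep_x (j : 'I_n) : op := diagop (fun s => vX (s j)).
Definition rep_t (l : 'I_n.-1) : op := monomx (swap l) (crossing l).

Let wtE nu : exists s, wt s = nu := wt_surj hbeta nu.

Lemma rep_rel a b : klr_rel Q rep_e rep_x rep_t a b -> a = b.
Proof.
case=> [nu nu'||j j'|j nu|l nu|l m h|l nu|l j nu|l m nu h].
- rewrite [LHS]diagopM; have [->|ne] := eqVneq nu nu'.
    by apply: monomx_ext => // s; rewrite -natrM mulnb andbb.
  rewrite -[RHS](@monomx0 k {perm 'I_n} S id); apply: monomx_ext => // s.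
  by case: eqP => [->|]; rewrite ?mul0r // (negbTE ne) mulr0.
- rewrite /rep_e [LHS]monomx_sum -[RHS](@diagop1 k {perm 'I_n} S).
  apply: monomx_ext => // s; rewrite (bigD1 (wt s)) //= eqxx big1 ?addr0 // => nu.
  by rewrite eq_sym => /negbTE->.
- by rewrite [LHS]diagopM [RHS]diagopM; apply: monomx_ext => // s; apply: mulrC.
- by rewrite [LHS]diagopM [RHS]diagopM; apply: monomx_ext => // s; apply: mulrC.
- rewrite [LHS]monomxM [RHS]monomxM; apply: monomx_ext => // s /=.
  have [s' <-] := wtE nu; rewrite wt_act !(inj_eq (wt_inj hi (hbeta := hbeta))).
  by rewrite (inj_eq (@swap_inj _ l)) mulrC.
- rewrite [LHS]monomxM [RHS]monomxM; apply: monomx_ext => s /=; first exact: swapC.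
  rewrite mulrC /crossing !swap_else // -val_eqE /=; by apply/eqP; lia.
- rewrite expr2 eval2_diagop [X in X * _ = _]monomxM [LHS]monomxM [RHS]diagopM.
  apply: monomx_ext => s /=; first exact: swapK.
  have [<-|] := eqVneq (wt s) nu; last by rewrite !mulr0.
  rewrite !mulr1 /crossing swap_posl swap_posr mulrC crossM ?tnth_wt //.
  by rewrite (inj_eq perm_inj) posl_neq.
- have [s' <-] := wtE nu; rewrite (wt_res_eq hi) posl_neq !andbF.
  rewrite -[RHS](mul0r (rep_e (wt s'))); congr (_ * _); apply/eqP; rewrite subr_eq0.
  rewrite [X in X == _]monomxM [X in _ == X]monomxM; apply/eqP.
  by apply: monomx_ext => // s /=; rewrite swapE tpermK mulrC.
- have [s' <-] := wtE nu; rewrite (wt_res_eq hi) -val_eqE /= h ltn_eqF //.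
  rewrite -[RHS](mul0r (rep_e (wt s'))); congr (_ * _); apply/eqP; rewrite subr_eq0.
  rewrite [X in X * _ == _]monomxM [X in X == _]monomxM.
  rewrite [X in _ == X * _]monomxM [X in _ == X]monomxM; apply/eqP.
  apply: monomx_ext => s /=; first exact: swap_braid.
  have el : posr l = posl m by apply: val_inj; rewrite /= h.
  have n1 : posl l != posl m by rewrite -val_eqE /= h ltn_eqF.
  have n2 : posl l != posr m by rewrite -val_eqE /= h ltn_eqF.
  have n3 : posr m != posl l by rewrite eq_sym.
  have n4 : posr m != posr l by rewrite el eq_sym posl_neq.
  have a1 : swap l (swap m s) (posl m) = s (posl l) by rewrite -el swap_posr swap_else.
  have a2 : swap l (swap m s) (posr m) = s (posl m) by rewrite swap_else // swap_posr.
  have a3 : swap m s (posl l) = s (posl l) by rewrite swap_else.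
  have a4 : swap m s (posr l) = s (posr m) by rewrite el swap_posl.
  have b1 : swap m (swap l s) (posl l) = s (posr l) by rewrite swap_else // swap_posl.
  have b2 : swap m (swap l s) (posr l) = s (posr m) by rewrite el swap_posl swap_else.
  have b3 : swap l s (posl m) = s (posl l) by rewrite -el swap_posr.
  have b4 : swap l s (posr m) = s (posr m) by rewrite swap_else.
  rewrite /crossing a1 a2 a3 a4 b1 b2 b3 b4 -el.
  by rewrite mulrC [W in _ * W = _]mulrC mulrA.
Qed.


(** This is the submodule by which the projective module of [mu] is divided in
the cyclotomic quotient. *)
Definition stable v := forall s, setideal y q (fun c => before s c :&: before mu c)
  (v s).

Lemma stable_ext v v' : v =1 v' -> stable v -> stable v'.
Proof. by move=> e h s; rewrite -e. Qed.

(** A crossing that restores the order of [mu] may enlarge one set of labels by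
[b], and the factor [q a b] pays for it; a crossing away from this order enlarges
no set. *)
Lemma stable_t l v : stable v -> stable (act (rep_t l) v).
Proof.
move=> hv s0; rewrite -[s0](swapK l); move: (swap l s0) => s.
rewrite act_monomx; last exact: swap_inj.
set a := s (posl l); set b := s (posr l).
have sub c : c != a -> before (swap l s) c :&: before mu c \subset
    before s c :&: before mu c.
  move=> nc; apply/subsetP => d; rewrite !inE => /andP[hd ->]; rewrite andbT.
  have := @before_swap_inv _ l s c d; rewrite !inE => /(_ hd)[//|[_ ec]].
  by rewrite ec eqxx in nc.
have sub_a : before (swap l s) a :&: before mu a \subset
    b |: (before s a :&: before mu a).
  apply/subsetP => d; rewrite !inE => /andP[hd ->]; rewrite andbT.
  have := @before_swap_inv _ l s a d; rewrite !inE => /(_ hd)[->|[-> _]].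
    by rewrite orbT.
  by rewrite eqxx.
rewrite /crossing -/a -/b /cross; case: ifP => hab.
  rewrite mul1r; apply: setideal_sub (hv s) => c.
  have [->|] := eqVneq c a; last exact: sub.
  apply/subsetP => d hd; have := subsetP sub_a d hd; rewrite inE => /orP[|//].
  rewrite inE => /eqP ed; move: hd; rewrite ed !inE => /andP[_].
  by rewrite ltnNge (ltnW hab).
apply: gen_ideal_mul_sub (hv s) => c.
have [->|nc] := eqVneq c a; last by apply: gen_idealMl; apply: setideal_mem; apply: sub.
have nb : b \notin before s a :&: before mu a.
  by rewrite !inE !permK_place /= ltnNge leqnSn.
rewrite /setpoly mulrCA -(big_setU1 _ nb).
exact: (setideal_mem y q (B := fun c => before (swap l s) c :&: before mu c)).
Qed.

Variable Psi : {rmorphism KLR Q n beta -> op}.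
Hypothesis Psi_scal : forall c, Psi (scal c) = scal c.
Hypothesis Psi_e : forall nu, Psi (klr_e Q nu) = rep_e nu.
Hypothesis Psi_x : forall j, Psi (klr_x Q beta j) = rep_x j.
Hypothesis Psi_t : forall l, Psi (klr_t Q beta l) = rep_t l.

Lemma stable_diagop d v : stable v -> stable (act (diagop d) v).
Proof. by move=> hv s; rewrite act_diagop; apply: gen_idealMl; apply: hv. Qed.

Lemma stable_klr a v : stable v -> stable (act (Psi a) v).
Proof.
move=> hv; elim/klr_ind: a => [|a b ha hb|c a ha|nu a ha|j a ha|l a ha].
- apply: stable_ext hv => s.
  by rewrite rmorph1 -(@diagop1 k {perm 'I_n} S) act_diagop mul1r.
- by move=> s; rewrite rmorphD actD; apply: gen_idealD; [apply: ha | apply: hb].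
- apply: (stable_ext (v := act (diagop (fun=> scal c)) (act (Psi a) v))).
    by move=> s; rewrite rmorphM actM Psi_scal diagop_scal.
  exact: stable_diagop.
- apply: (stable_ext (v := act (rep_e nu) (act (Psi a) v))); last exact: stable_diagop.
  by move=> s; rewrite rmorphM actM Psi_e.
- apply: (stable_ext (v := act (rep_x j) (act (Psi a) v))); last exact: stable_diagop.
  by move=> s; rewrite rmorphM actM Psi_x.
- apply: (stable_ext (v := act (rep_t l) (act (Psi a) v))); last exact: stable_t.
  by move=> s; rewrite rmorphM actM Psi_t.
Qed.

(** At [s] the generator acts by the polynomial of the first letter, whose set of
preceding letters is empty. Two-sided multiples follow since the subspace is
stable. *)
Lemma stable_cyclotomic a v : in_ideal (cyclotomic_gen L) a -> stable (act (Psi a) v).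
Proof.
move=> h; elim: h v => {a} [a [j0 ej0 ->] v|v s|a b _ ha _ hb v s|c a _ ha v|c a _ ha
  v].
- have E : Psi (\sum_(nu : weight_seq n beta) klr_x Q beta j0 ^+
      `|scoroot C (tnth (val nu) j0) L|%N * klr_e Q nu) = diagop (fun s => y (s j0)).
    rewrite rmorph_sum.
    pose d (nu : weight_seq n beta) (s : {perm 'I_n}) : S :=
      vX (s j0) ^+ `|scoroot C (tnth (val nu) j0) L|%N * (wt s == nu)%:R.
    rewrite (eq_bigr (fun nu => diagop (d nu))) => [|nu _]; last first.
      rewrite rmorphM rmorphXn Psi_x Psi_e [rep_x _ ^+ _]diagopX; exact: diagopM.
    rewrite [LHS]monomx_sum; apply: monomx_ext => // s.
    rewrite (bigD1 (wt s)) //= big1 ?addr0 /d => [|nu]; last first.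
      by rewrite eq_sym => /negbTE->; rewrite mulr0.
    by rewrite eqxx mulr1 tnth_wt.
  move=> s; rewrite E act_diagop mulrC; apply: gen_idealMl.
  have := @setideal_mem _ _ y q (fun c => before s c :&: before mu c) (s j0) set0.
  rewrite /setpoly big_set0 mulr1; apply; apply/subsetP => d.
  by rewrite !inE permK_place ej0 ltn0.
- by rewrite rmorph0 act0; apply: gen_ideal0.
- by rewrite rmorphB actB; apply: gen_idealB; [apply: ha | apply: hb].
- apply: (stable_ext (v := act (Psi c) (act (Psi a) v))); last exact: stable_klr.
  by move=> s; rewrite rmorphM actM.
- apply: (stable_ext (v := act (Psi a) (act (Psi c) v))); last exact: ha.
  by move=> s; rewrite rmorphM actM.
Qed.

Let H := klr_rel_perm hi hbeta (@klr_relE _ C k Q n beta) (@klr_ind _ C k Q n beta).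

Lemma Psi_phi f : Psi (phi H f) = diagop (fun=> f).
Proof.
apply: (@polyR_morph_eq k n op (Psi \o phi H) (@cstop k {perm 'I_n} S)) => [c|a] /=.
  by rewrite phi_scal Psi_scal diagop_scal.
rewrite phi_varX rmorph_sum.
rewrite (eq_bigr (fun s => diagop (fun s' => vX (s' (place s a)) * (wt s' == wt s)%:R)))
  => [|s _]; last by rewrite rmorphM Psi_x Psi_e; apply: diagopM.
rewrite [LHS]monomx_sum; apply: monomx_ext => // s.
rewrite (bigD1 s) //= eqxx mulr1 placeK big1 ?addr0 // => s' ns.
by rewrite (inj_eq (wt_inj hi (hbeta := hbeta))) eq_sym (negbTE ns) mulr0.
Qed.

(** Apply the element to the basis vector of [mu]: the crossing leaves the order of
[mu] without any factor, so the component at [swap l mu] is [f] itself. *)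
Lemma cyclotomic_crossing l f :
  in_ideal (cyclotomic_gen L) (phi H f * (klr_t Q beta l * klr_e Q (wt mu))) ->
  setideal y q (fun c => before mu c :&: before (swap l mu) c) f.
Proof.
move/stable_cyclotomic=> /(_ (fun s => (s == mu)%:R) (swap l mu)).
rewrite !rmorphM Psi_phi Psi_t Psi_e actM act_diagop actM act_monomx;
  last exact: swap_inj.
rewrite act_diagop !eqxx !mulr1 /crossing /cross !permK_place ltnSn mulr1.
by apply: setideal_sub => c; rewrite setIC.
Qed.

End Representation.

(** * Surjectivity on centers *)

Section CyclotomicIdeal.
Variables (I : finType) (C : cartan_datum I) (k : fieldType).
Variables (Q : I -> I -> {poly {poly k}}) (hQ : klr_polys C Q).
Variables (n : nat) (i : n.-tuple I) (A : pzAlgType k).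
Variables (e : 'S_n -> A) (x : 'I_n -> A) (t : 'I_n.-1 -> A) (L : wlat C).
Hypothesis H : perm_klr (fun a b => Q (tnth i a) (tnth i b)) e x t.
Variable R : A -> Prop.
Local Notation q := (qpoly Q i).
Local Notation y := (ypoly k i L).
Hypothesis R_first : forall j : 'I_n, j = 0 :> nat -> forall s : 'S_n,
  in_ideal R (x j ^+ `|scoroot C (tnth i (s j)) L|%N * e s).

Lemma before_shift l (s : 'S_n) :
  before s (s (posr l)) = s (posl l) |: before (swap l s) (s (posr l)).
Proof.
apply/setP => d; rewrite !inE !place_swap permK_place tpermR.
rewrite -(inj_eq (@place_inj _ s)) permK_place val_transp -val_eqE /=.
by do !case: eqP; lia.
Qed.

(** Conjugating by the crossing of [a] with its left neighbour [b] multiplies the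
polynomial by [q a b], which adds [b] to the set of letters before [a]. *)
Lemma setpoly_in_ideal s a :
  in_ideal R (phi H (setpoly y q a (before s a)) * e s).
Proof.
move: {2}(nat_of_ord (place s a)) (erefl (nat_of_ord (place s a))) => p.
elim: p s a => [|p IH] s a ep.
  have -> : before s a = set0 by apply/setP => b; rewrite !inE ep.
  have := R_first ep s; rewrite placeK (xX_e H) placeK.
  by rewrite /setpoly big_set0 mulr1.
have hl : (p < n.-1)%N by have := ltn_ord (place s a); rewrite ep; lia.
pose l : 'I_n.-1 := Ordinal hl.
have ea : a = s (posr l).
  by rewrite -[LHS](placeK s); congr (s _); apply: val_inj; rewrite /= ep.
have nb : s (posl l) \notin before (swap l s) a.
  by rewrite inE !place_swap ea !permK_place tpermL tpermR -leqNgt leqnSn.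
have := IH (swap l s) a.
rewrite place_swap {1}ea permK_place tpermR => /(_ erefl) h.
have := in_ideal_Mr (t l) (in_ideal_Ml (t l) h).
rewrite mulrA -(phiC H) -!mulrA -(pklr_te H) !mulrA -[_ * t l * t l]mulrA -[_ * (t l
  * t l) * _]mulrA.
rewrite (tt_e H) mulrA -rmorphM.
have -> : setpoly y q a (before s a) = setpoly y q a (before (swap l s) a) *
  swap_poly (fun a b => Q (tnth i a) (tnth i b)) l s.
  rewrite ea before_shift -ea /setpoly (big_setU1 _ nb) /= [_ * \prod_(_ in _)
    _]mulrC mulrA.
  by congr (_ * _); rewrite (qpoly_sym hQ) {1}ea.
by [].
Qed.

Hypothesis hi : uniq i.
Hypothesis R_crossing : forall l s f, in_ideal R (phi H f * (t l * e s)) ->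
  setideal y q (fun c => before s c :&: before (swap l s) c) f.

Lemma center_pi_surj (z : 'Z[idealquot R]) : exists w : 'Z[A], center_pi R w = z.
Proof.
have [a ea] := quot_pi_surj (val z).
have central b : quot_pi R a * b = b * quot_pi R a.
  by rewrite ea; have /centerP := valP z; apply.
have [F hF] := fin_all_exists (diag_corner H a).
have [f hf] : exists f, forall s, setideal y q (before s) (f - F s).
  apply: (@glue _ _ _ _ (@isolate k n) (@varX k n)).
  - exact: isolateK.
  - exact: ypoly_lead.
  - exact: ypoly_free.
  - exact: (qpoly_lead hQ hi).
  - exact: qpoly_free.
  move=> l s; apply: R_crossing.
  have := @pi_crossing _ _ _ _ _ _ _ H _ (quot_pi R) a F central hF l s.
  by rewrite -(rmorph0 (quot_pi R)) => /quot_pi_eq; rewrite subr0.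
exists (phiZ H f); apply: val_inj; rewrite -ea.
apply: (@pi_lift _ _ _ _ _ _ _ H _ (quot_pi R) a F central hF) => s.
rewrite -(rmorph0 (quot_pi R)); apply/quot_pi_eq; rewrite subr0.
case: (hf s) => u ->; rewrite rmorph_sum mulr_suml.
apply: big_ind => [|b c hb hc|c _].
- exact: in_ideal_0.
- by rewrite -[c]opprK; apply: in_ideal_B => //; rewrite -mulN1r; apply: in_ideal_Ml.
- by rewrite rmorphM -mulrA; apply: in_ideal_Ml; apply: setpoly_in_ideal.
Qed.
End CyclotomicIdeal.

Theorem theorem4p16 (I : finType) (C : cartan_datum I) (k : fieldType)
  (Q : I -> I -> {poly {poly k}}) (hQ : klr_polys C Q)
  (n : nat) (i : n.-tuple I) (hi : uniq i) (beta : wlat C)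
  (hbeta : beta = \sum_(j < n) sroot C (tnth i j))
  (L : wlat C) (hL : dominant L) :
  forall z : 'Z[cycKLR Q n beta L],
    exists w : 'Z[KLR Q n beta], klr_center_map L w = z.
Proof.
pose H := klr_rel_perm hi hbeta (@klr_relE _ C k Q n beta) (@klr_ind _ C k Q n beta).
apply: (@center_pi_surj _ _ _ _ hQ _ _ _ _ _ _ L H (cyclotomic_gen L) _ hi).
- move=> j ej s.
  have := in_ideal_Mr (klr_e Q (wt hbeta s))
    (in_ideal_gen (ex_intro2 _ _ j ej erefl : cyclotomic_gen L _)).
  by rewrite (sum_mul_e (@klr_relE _ C k Q n beta)) tnth_wt => r; exact: r.
- move=> l s f h.
  have [Psi [Pc Pe Px Pt]] := klr_univ (@rep_rel _ _ _ _ hQ _ _ hi _ hbeta s).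
  exact: (cyclotomic_crossing Pc Pe Px Pt h).
Qed.
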